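(* Let $(\Omega,\mathscr H,\hat{\mathbb E})$ be a sub-linear expectation space and let $X,X_1,X_2,\dots\in\mathscr H$ be such that $\{X_n;n\ge1\}$ is independent and $X_n\overset{d}{=}X$ for every $n$, with $\hat{\mathbb E}[X]=\hat{\mathcal E}[X]=0$. Put $S_n=X_1+\dots+X_n$, $V_n^2=X_1^2+\dots+X_n^2$ and $l(x)=\hat{\mathbb E}[X^2\wedge x^2]$. Suppose (I) $\mathbb V(|X|\ge x)=o\big(x^{-2}l(x)\big)$ as $x\to\infty$; (II) $\limsup_{x\to\infty}\frac{\hat{\mathbb E}[X^2\wedge x^2]}{\hat{\mathcal E}[X^2\wedge x^2]}<\infty$; (III) $\hat{\mathbb E}[(|X|-c)^+]\to0$ as $c\to\infty$; (IV) $\{x_n\}$ is a real sequence with $x_n\to\infty$ and $x_n=o(\sqrt n)$ as $n\to\infty$. Then $$\lim_{n\to\infty}x_n^{-2}\ln\mathbb V(S_n\ge x_nV_n)=-\frac12.$$ Further, if the condition $\hat{\mathbb E}[X]=\hat{\mathcal E}[X]=0$ is replaced by $\hat{\mathbb E}[X]\le0$ (all other hypotheses unchanged), then $$\limsup_{n\to\infty}x_n^{-2}\ln\mathbb V(S_n\ge x_nV_n)\le-\frac12.$$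
   Context: Setting: $(\Omega,\mathcal F)$ is a measurable space and $\mathscr H$ is a linear space of real functions on $\Omega$ such that $\varphi(X_1,\dots,X_n)\in\mathscr H$ whenever $X_1,\dots,X_n\in\mathscr H$ and $\varphi\in C_b(\mathbb R^n)\cup C_{l,Lip}(\mathbb R^n)$ ($C_b$: bounded continuous functions; $C_{l,Lip}$: functions with $|\varphi(x)-\varphi(y)|\le C(1+|x|^m+|y|^m)|x-y|$ for some $C>0,m\in\mathbb N$). A sub-linear expectation $\hat{\mathbb E}:\mathscr H\to[-\infty,\infty]$ is monotone, constant preserving, sub-additive ($\hat{\mathbb E}[X+Y]\le\hat{\mathbb E}[X]+\hat{\mathbb E}[Y]$ whenever the right side is not $\infty-\infty$) and positively homogeneous. $\hat{\mathcal E}[X]=-\hat{\mathbb E}[-X]$. $\mathbb V(A)=\inf\{\hat{\mathbb E}[\xi]:I_A\le\xi,\ \xi\in\mathscr H\}$ for $A\in\mathcal F$. Independence: $\mathbf Y=(Y_1,\dots,Y_n)$ is independent of $\mathbf X=(X_1,\dots,X_m)$ if $\hat{\mathbb E}[\varphi(\mathbf X,\mathbf Y)]=\hat{\mathbb E}\big[\hat{\mathbb E}[\varphi(\mathbf x,\mathbf Y)]|_{\mathbf x=\mathbf X}\big]$ for all $\varphi\in C_{l,Lip}(\mathbb R^{m+n})$ with $\bar\varphi(\mathbf x):=\hat{\mathbb E}[|\varphi(\mathbf x,\mathbf Y)|]<\infty$ for all $\mathbf x$ and $\hat{\mathbb E}[|\bar\varphi(\mathbf X)|]<\infty$; $\{X_n\}$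 is independent if $X_{i+1}$ is independent of $(X_1,\dots,X_i)$ for every $i$. $X_n\overset d=X$ means $\hat{\mathbb E}[\varphi(X_n)]=\hat{\mathbb E}[\varphi(X)]$ for all $\varphi\in C_{l,Lip}(\mathbb R)$ (whenever finite). $a\wedge b=\min(a,b)$. *)

(* Defs.v *)
From Stdlib Require Import Reals Lra.
From Coquelicot Require Import Coquelicot.
Open Scope R_scope.

(* Vectors of R^n are encoded as x : nat -> R, of which only the
   coordinates 0..n-1 are relevant.  nrm n x = max_{i<n} |x i| (a norm on
   R^n equivalent to the Euclidean one, hence giving the same classes
   C_b(R^n) and C_{l,Lip}(R^n)). *)
Fixpoint nrm (n : nat) (x : nat -> R) : R :=
  match n with
  | O => 0
  | S k => Rmax (nrm k x) (Rabs (x k))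
  end.

Definition vsub (x y : nat -> R) : nat -> R := fun i => x i - y i.

Definition Cb (n : nat) (phi : (nat -> R) -> R) : Prop :=
  (exists B : R, forall x, Rabs (phi x) <= B) /\
  (forall x (eps : R), 0 < eps -> exists d : R, 0 < d /\
     forall y, nrm n (vsub x y) < d -> Rabs (phi x - phi y) < eps).

Definition ClLip (n : nat) (phi : (nat -> R) -> R) : Prop :=
  exists (C : R) (m : nat), 0 < C /\
    forall x y, Rabs (phi x - phi y)
                <= C * (1 + nrm n x ^ m + nrm n y ^ m) * nrm n (vsub x y).

(* The space H of random variables together with the sub-linear expectation E
   (E is a total function on Omega -> R, only its values on H matter). *)
Definition sublinear_space {Omega : Type} (H : (Omega -> R) -> Prop)
    (E : (Omega -> R) -> Rbar) : Prop :=
  (forall X Y, H X -> H Y -> H (fun w => X w + Y w)) /\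
  (forall (c : R) X, H X -> H (fun w => c * X w)) /\
  (forall (n : nat) (Xv : nat -> Omega -> R) (phi : (nat -> R) -> R),
     (forall i, (i < n)%nat -> H (Xv i)) -> (Cb n phi \/ ClLip n phi) ->
     H (fun w => phi (fun j => Xv j w))) /\
  (forall X Y, H X -> H Y -> (forall w, X w <= Y w) -> Rbar_le (E X) (E Y)) /\
  (forall c : R, E (fun _ => c) = Finite c) /\
  (forall X Y, H X -> H Y -> ex_Rbar_plus (E X) (E Y) ->
     Rbar_le (E (fun w => X w + Y w)) (Rbar_plus (E X) (E Y))) /\
  (forall (l : R) X, H X -> 0 < l ->
     E (fun w => l * X w) = Rbar_mult (Finite l) (E X)).

Definition calE {Omega : Type} (E : (Omega -> R) -> Rbar) (X : Omega -> R) : Rbar :=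
  Rbar_opp (E (fun w => - X w)).

Definition Vcap {Omega : Type} (H : (Omega -> R) -> Prop)
    (E : (Omega -> R) -> Rbar) (A : Omega -> Prop) : Rbar :=
  Glb_Rbar (fun r : R => exists xi, H xi /\
     (forall w, 0 <= xi w /\ (A w -> 1 <= xi w)) /\ E xi = Finite r).

Definition vcat (m : nat) (x y : nat -> R) : nat -> R :=
  fun j => if Nat.ltb j m then x j else y (j - m)%nat.

(* Y = (Yv 0,..,Yv (n-1)) is independent of X = (Xv 0,..,Xv (m-1)) *)
Definition indep_vec {Omega : Type} (H : (Omega -> R) -> Prop)
    (E : (Omega -> R) -> Rbar) (m : nat) (Xv : nat -> Omega -> R)
    (n : nat) (Yv : nat -> Omega -> R) : Prop :=
  forall phi : (nat -> R) -> R, ClLip (m + n) phi ->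
    let inner := fun x : nat -> R => E (fun w => phi (vcat m x (fun j => Yv j w))) in
    let phibar := fun x : nat -> R =>
      E (fun w => Rabs (phi (vcat m x (fun j => Yv j w)))) in
    (forall x, Rbar_lt (phibar x) p_infty) ->
    H (fun w => real (inner (fun j => Xv j w))) ->
    H (fun w => Rabs (real (phibar (fun j => Xv j w)))) ->
    Rbar_lt (E (fun w => Rabs (real (phibar (fun j => Xv j w))))) p_infty ->
    E (fun w => phi (vcat m (fun j => Xv j w) (fun j => Yv j w)))
    = E (fun w => real (inner (fun j => Xv j w))).

(* {Xs 0, Xs 1, ...} (= X_1, X_2, ...) is independent *)
Definition indep_seq {Omega : Type} (H : (Omega -> R) -> Prop)
    (E : (Omega -> R) -> Rbar) (Xs : nat -> Omega -> R) : Prop :=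
  forall i : nat, indep_vec H E i Xs 1 (fun _ => Xs i).

Definition ident_distr {Omega : Type} (E : (Omega -> R) -> Rbar)
    (Y X : Omega -> R) : Prop :=
  forall phi : (nat -> R) -> R, ClLip 1 phi ->
    (is_finite (E (fun w => phi (fun _ => Y w))) \/
     is_finite (E (fun w => phi (fun _ => X w)))) ->
    E (fun w => phi (fun _ => Y w)) = E (fun w => phi (fun _ => X w)).

(* partial sums: psum f n = f 0 + ... + f (n-1); so with Xs i = X_{i+1},
   S_n = psum (fun i => Xs i w) n and V_n^2 = psum (fun i => (Xs i w)^2) n *)
Fixpoint psum (f : nat -> R) (n : nat) : R :=
  match n with
  | O => 0
  | S k => psum f k + f k
  end.

(* Main.v *)
Require Import Defs.
From Stdlib Require Import Reals.
From Coquelicot Require Import Coquelicot.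
From Stdlib Require Import Lra Lia FunctionalExtensionality Classical.
Open Scope R_scope.

(* Put p(b) = E[(bX)^2 /\ 1] and choose b with n p(b) = x_n^2.  For a bounded
   Lipschitz G >= 0 with G(u) = exp(a u + d u^2) near 0, conditions (I) and (III) give
   E[G(bX)] <= 1 + (a^2/2 + d) p(b) + o(p(b)), with a matching lower bound when
   E[X] = E[-X] = 0, and by independence the product of the G(b X_i) has expectation
   E[G(bX)]^n = exp((a^2/2 + d + o(1)) x_n^2).  Both bounds compare the indicator of
   {S_n >= x_n V_n} pointwise with finite sums of such products.
   Upper bound: weights exp(t u - t^2 u^2/2), for which a^2/2 + d = 0, with t in a finite
   geometric grid adapted to b V_n / x_n; very small V_n is excluded by exp(-T u^2)
   together with (II), very large V_n by a truncation.
   Lower bound: a tilted product minus three neighbouring tilts (Gartner-Ellis); no change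
   of measure is needed, since E[U - W] >= E[U] - E[W]. *)

(** * Lipschitz functions on the line *)

(** The obstacle is variance uncertainty: the truncated second moment is only known to lie between
    its lower and upper expectations, so a weight whose exponent keeps a multiple of that moment
    need not give the constant 1/2. The choice d = -a^2/2 removes the moment altogether, and
    completing the square then extracts nearly exp(x_n^2/2) from S_n >= x_n V_n once t matches V_n;
    the grid is needed because n does not determine the size of V_n. For a weight with a^2/2 + d <
    0, sub-additivity yields the lower second moment instead of p(b), and this is where (II) has to
    compare the two. In the lower bound all coefficients a^2/2 + d are positive, so the main term
    and the subtracted weights are measured by the same p(b), and only their coefficients compete.
    Everything about a single variable concerns the functional f -> E[f(X)] on Lipschitz f.
    Condition (III) makes it real-valued, which confines infinite values to the interface with [E]
    and [Vcap]. *)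

Definition lip (f : R -> R) : Prop :=
  exists L, 0 <= L /\ forall u v, Rabs (f u - f v) <= L * Rabs (u - v).

Definition blip (f : R -> R) : Prop :=
  lip f /\ exists B, 0 <= B /\ forall u, Rabs (f u) <= B.

Lemma lip_const c : lip (fun _ => c).
Proof.
  exists 0; split; [lra|]; intros u v.
  replace (c - c) with 0 by ring; rewrite Rabs_R0; lra.
Qed.

Lemma lip_id : lip (fun u => u).
Proof. exists 1; split; [lra|]; intros; lra. Qed.

Lemma lip_plus f g : lip f -> lip g -> lip (fun u => f u + g u).
Proof.
  intros [L [L0 HL]] [K [K0 HK]]; exists (L + K); split; [lra|]; intros u v.
  replace (f u + g u - (f v + g v)) with ((f u - f v) + (g u - g v)) by ring.
  eapply Rle_trans; [apply Rabs_triang|].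
  rewrite Rmult_plus_distr_r; apply Rplus_le_compat; auto.
Qed.

Lemma lip_scal c f : lip f -> lip (fun u => c * f u).
Proof.
  intros [L [L0 HL]]; exists (Rabs c * L); split.
  - apply Rmult_le_pos; [apply Rabs_pos|exact L0].
  - intros u v; rewrite <- Rmult_minus_distr_l, Rabs_mult, Rmult_assoc.
    apply Rmult_le_compat_l; [apply Rabs_pos|auto].
Qed.

Lemma lip_comp f g : lip f -> lip g -> lip (fun u => f (g u)).
Proof.
  intros [L [L0 HL]] [K [K0 HK]]; exists (L * K); split.
  - apply Rmult_le_pos; assumption.
  - intros u v; eapply Rle_trans; [apply HL|].
    rewrite Rmult_assoc; apply Rmult_le_compat_l; auto.
Qed.

Lemma lip_ext f g : (forall u, f u = g u) -> lip f -> lip g.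
Proof.
  intros E [L [L0 HL]]; exists L; split; [exact L0|].
  intros u v; rewrite <- !E; apply HL.
Qed.

Lemma lip_minus f g : lip f -> lip g -> lip (fun u => f u - g u).
Proof.
  intros Hf Hg; apply lip_ext with (fun u => f u + (-1) * g u).
  - intros; ring.
  - apply lip_plus; [|apply lip_scal]; assumption.
Qed.

Lemma lip_opp f : lip f -> lip (fun u => - f u).
Proof.
  intros Hf; apply lip_ext with (fun u => (-1) * f u).
  - intros; ring.
  - apply lip_scal; assumption.
Qed.

Lemma lip_dil b f : lip f -> lip (fun u => f (b * u)).
Proof. intros Hf; apply (lip_comp f (fun u => b * u) Hf (lip_scal b _ lip_id)). Qed.

Lemma lip_abs f : lip f -> lip (fun u => Rabs (f u)).
Proof.
  intros Hf; apply (lip_comp Rabs f); [|exact Hf].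
  exists 1; split; [lra|]; intros u v; rewrite Rmult_1_l; apply Rabs_triang_inv2.
Qed.

Lemma Rabs_Rmax a c d : Rabs (Rmax a d - Rmax c d) <= Rabs (a - c).
Proof.
  unfold Rmax; destruct (Rle_dec a d), (Rle_dec c d); unfold Rabs;
    repeat destruct Rcase_abs; lra.
Qed.

Lemma Rabs_Rmin a c d : Rabs (Rmin a d - Rmin c d) <= Rabs (a - c).
Proof.
  unfold Rmin; destruct (Rle_dec a d), (Rle_dec c d); unfold Rabs;
    repeat destruct Rcase_abs; lra.
Qed.

Lemma lip_max f d : lip f -> lip (fun u => Rmax (f u) d).
Proof.
  intros [L [L0 HL]]; exists L; split; [exact L0|]; intros u v.
  eapply Rle_trans; [apply Rabs_Rmax|auto].
Qed.

Lemma lip_min f d : lip f -> lip (fun u => Rmin (f u) d).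
Proof.
  intros [L [L0 HL]]; exists L; split; [exact L0|]; intros u v.
  eapply Rle_trans; [apply Rabs_Rmin|auto].
Qed.

Lemma blip_const c : blip (fun _ => c).
Proof.
  split; [apply lip_const|exists (Rabs c); split; [apply Rabs_pos|intros; lra]].
Qed.

Lemma blip_plus f g : blip f -> blip g -> blip (fun u => f u + g u).
Proof.
  intros [Hf [B [B0 HB]]] [Hg [D [D0 HD]]]; split; [apply lip_plus; assumption|].
  exists (B + D); split; [lra|]; intros u.
  eapply Rle_trans; [apply Rabs_triang|apply Rplus_le_compat; auto].
Qed.

Lemma blip_mult f g : blip f -> blip g -> blip (fun u => f u * g u).
Proof.
  intros [[L [L0 HL]] [B [B0 HB]]] [[K [K0 HK]] [D [D0 HD]]]; split.
  - exists (L * D + B * K); split.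
    + apply Rplus_le_le_0_compat; apply Rmult_le_pos; assumption.
    + intros u v.
      replace (f u * g u - f v * g v)
        with ((f u - f v) * g u + f v * (g u - g v)) by ring.
      eapply Rle_trans; [apply Rabs_triang|]; rewrite !Rabs_mult, Rmult_plus_distr_r.
      apply Rplus_le_compat.
      * replace (L * D * Rabs (u - v)) with ((L * Rabs (u - v)) * D) by ring.
        apply Rmult_le_compat; auto using Rabs_pos.
      * rewrite Rmult_assoc; apply Rmult_le_compat; auto using Rabs_pos.
  - exists (B * D); split; [apply Rmult_le_pos; assumption|]; intros u.
    rewrite Rabs_mult; apply Rmult_le_compat; auto using Rabs_pos.
Qed.

Lemma exp_le a b : a <= b -> exp a <= exp b.
Proof.
  intros [h|h]; [left; apply exp_increasing, h|rewrite h; apply Rle_refl].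
Qed.

Lemma MVT_bound f f' a b K :
  (forall t, Rmin a b <= t <= Rmax a b -> derivable_pt_lim f t (f' t)) ->
  (forall t, Rmin a b <= t <= Rmax a b -> Rabs (f' t) <= K) ->
  Rabs (f b - f a) <= K * Rabs (b - a).
Proof.
  intros Hd HK; destruct (MVT_abs f f' a b Hd) as [t [Ht1 Ht2]].
  rewrite Ht1; apply Rmult_le_compat_r; [apply Rabs_pos|auto].
Qed.

Lemma blip_exp f : blip f -> blip (fun u => exp (f u)).
Proof.
  intros [[L [L0 HL]] [B [B0 HB]]]; split.
  - exists (exp B * L); split.
    + apply Rmult_le_pos; [left; apply exp_pos|assumption].
    + intros u v; eapply Rle_trans.
      * apply MVT_bound with (f' := exp) (K := exp B).
        -- intros; apply derivable_pt_lim_exp.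
        -- intros t [_ Ht]; rewrite Rabs_pos_eq by (left; apply exp_pos).
           apply exp_le; eapply Rle_trans; [exact Ht|].
           generalize (HB u) (HB v) (Rle_abs (f u)) (Rle_abs (f v)).
           intros; apply Rmax_lub; lra.
      * rewrite Rmult_assoc; apply Rmult_le_compat_l; [left; apply exp_pos|auto].
  - exists (exp B); split; [left; apply exp_pos|]; intros u.
    rewrite Rabs_pos_eq by (left; apply exp_pos).
    apply exp_le; eapply Rle_trans; [apply Rle_abs|auto].
Qed.

Lemma blip_dil b f : blip f -> blip (fun u => f (b * u)).
Proof.
  intros [Hf [B [B0 HB]]]; split; [apply lip_dil; assumption|].
  exists B; split; [assumption|intros; apply HB].
Qed.

(** * Clamping, cutoff and the cubic remainder *)

Definition clamp (M u : R) : R := Rmax (Rmin u M) (- M).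

(** A Lipschitz stand-in for the indicator of |u| >= 1. It vanishes on |u| <= 1/2, so expansions at
    the origin do not see it. *)
Definition cutoff (u : R) : R := Rmax (Rmin (2 * Rabs u - 1) 1) 0.

(** Majorant of the Taylor remainder: cubic near the origin, and linear at infinity because the term
    a u of the expansion is unbounded while the weight is bounded. *)
Definition rmd (u : R) : R := Rabs (clamp 1 u) ^ 3 + Rmax (Rabs u - 1) 0.

Lemma blip_clamp M : 0 <= M -> blip (clamp M).
Proof.
  intros HM; split.
  - apply lip_max, lip_min, lip_id.
  - exists M; split; [exact HM|]; intros u; unfold clamp, Rmax, Rmin.
    apply Rabs_le; destruct (Rle_dec u M);
      match goal with |- context [Rle_dec ?a ?b] => destruct (Rle_dec a b) end; lra.
Qed.

Lemma clamp_id M u : Rabs u <= M -> clamp M u = u.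
Proof.
  intros Hu; apply Rabs_le_between in Hu; unfold clamp.
  rewrite Rmin_left, Rmax_left; lra.
Qed.

Lemma clamp_big M u : 0 <= M -> M <= Rabs u -> Rabs (clamp M u) = M.
Proof.
  intros HM Hu; unfold clamp, Rmax, Rmin, Rabs in *.
  destruct (Rcase_abs u), (Rle_dec u M);
    match goal with |- context [Rle_dec ?a ?b] => destruct (Rle_dec a b) end;
    match goal with |- context [Rcase_abs ?a] => destruct (Rcase_abs a) end; lra.
Qed.

Lemma clamp_sq_le1 u : clamp 1 u ^ 2 <= 1.
Proof.
  rewrite <- pow2_abs.
  destruct (Rle_lt_dec (Rabs u) 1) as [h|h].
  - rewrite clamp_id by exact h; generalize (Rabs_pos u); intros; nra.
  - rewrite clamp_big; lra.
Qed.

Lemma clamp_sq_le u : clamp 1 u ^ 2 <= u ^ 2.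
Proof.
  destruct (Rle_lt_dec (Rabs u) 1) as [h|h].
  - rewrite clamp_id by exact h; lra.
  - rewrite <- (pow2_abs u), <- pow2_abs, clamp_big by lra; nra.
Qed.

Lemma clamp_sq_big u : 1 <= Rabs u -> clamp 1 u ^ 2 = 1.
Proof. intros; rewrite <- pow2_abs, clamp_big by lra; ring. Qed.

Lemma blip_cutoff : blip cutoff.
Proof.
  split.
  - apply lip_max, lip_min, lip_minus; [apply lip_scal, lip_abs, lip_id|apply lip_const].
  - exists 1; split; [lra|]; intros u; unfold cutoff, Rmax, Rmin.
    apply Rabs_le.
    match goal with |- context [Rle_dec ?a 1] => destruct (Rle_dec a 1) end;
    match goal with |- context [Rle_dec ?a 0] => destruct (Rle_dec a 0) end; lra.
Qed.

Lemma cutoff_range u : 0 <= cutoff u <= 1.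
Proof.
  unfold cutoff, Rmax, Rmin.
  match goal with |- context [Rle_dec ?a 1] => destruct (Rle_dec a 1) end;
  match goal with |- context [Rle_dec ?a 0] => destruct (Rle_dec a 0) end; lra.
Qed.

Lemma cutoff_small u : Rabs u <= 1 / 2 -> cutoff u = 0.
Proof. intros; unfold cutoff; rewrite Rmin_left by lra; apply Rmax_right; lra. Qed.

Lemma cutoff_big u : 1 <= Rabs u -> cutoff u = 1.
Proof. intros; unfold cutoff; rewrite Rmin_right by lra; apply Rmax_left; lra. Qed.

Lemma lip_rmd : lip rmd.
Proof.
  unfold rmd; apply lip_plus.
  - assert (Hb : blip (fun u => Rabs (clamp 1 u))).
    { destruct (blip_clamp 1 ltac:(lra)) as [H1 [B [B0 HB]]]; split.
      - apply lip_abs, H1.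
      - exists B; split; [exact B0|]; intros u; rewrite Rabs_Rabsolu; auto. }
    apply (blip_mult _ _ Hb (blip_mult _ _ Hb (blip_mult _ _ Hb (blip_const 1)))).
  - apply lip_max, lip_minus; [apply lip_abs, lip_id|apply lip_const].
Qed.

Lemma rmd_small u : Rabs u <= 1 -> rmd u = Rabs u ^ 3.
Proof. intros; unfold rmd; rewrite clamp_id, Rmax_right by lra; ring. Qed.

Lemma rmd_big u : 1 / 2 <= Rabs u -> Rabs u <= 4 * rmd u.
Proof.
  intros h; destruct (Rle_lt_dec (Rabs u) 1) as [h1|h1].
  - rewrite rmd_small by exact h1; nra.
  - unfold rmd; rewrite clamp_big, Rmax_left by lra; lra.
Qed.

Lemma rmd_pos u : 0 <= rmd u.
Proof.
  unfold rmd; apply Rplus_le_le_0_compat; [apply pow_le, Rabs_pos|apply Rmax_r].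
Qed.

(** Three applications of the mean value theorem: each remainder is the derivative of the next one,
    and every step gains a factor |y|. *)
Lemma exp_remainder y :
  Rabs (exp y - (1 + y + y ^ 2 / 2)) <= Rabs y ^ 3 * exp (Rabs y).
Proof.
  assert (Hseg : forall z t, Rmin 0 z <= t <= Rmax 0 z -> Rabs t <= Rabs z).
  { intros z t; unfold Rmin, Rmax, Rabs; destruct (Rle_dec 0 z);
      repeat destruct Rcase_abs; lra. }
  assert (Hmon : forall k z t, Rabs t <= Rabs z ->
            Rabs t ^ k * exp (Rabs t) <= Rabs z ^ k * exp (Rabs z)).
  { intros k z t Ht; apply Rmult_le_compat.
    - apply pow_le, Rabs_pos.
    - left; apply exp_pos.
    - apply pow_incr; split; [apply Rabs_pos|exact Ht].
    - apply exp_le, Ht. }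
  assert (H1 : forall z, Rabs (exp z - 1) <= Rabs z ^ 1 * exp (Rabs z)).
  { intros z.
    assert (h := MVT_bound exp exp 0 z (exp (Rabs z))).
    rewrite exp_0, Rminus_0_r in h.
    replace (Rabs z ^ 1 * exp (Rabs z)) with (exp (Rabs z) * Rabs z) by ring.
    apply h.
    - intros; apply derivable_pt_lim_exp.
    - intros t Ht; rewrite Rabs_pos_eq by (left; apply exp_pos).
      apply exp_le; eapply Rle_trans; [apply Rle_abs|auto]. }
  assert (H2 : forall z, Rabs (exp z - (1 + z)) <= Rabs z ^ 2 * exp (Rabs z)).
  { intros z.
    assert (h := MVT_bound (fun t => exp t - (1 + t)) (fun t => exp t - 1) 0 z
                   (Rabs z ^ 1 * exp (Rabs z))).
    cbv beta in h; rewrite exp_0, Rminus_0_r in h.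
    replace (exp z - (1 + z) - (1 - (1 + 0))) with (exp z - (1 + z)) in h by ring.
    replace (Rabs z ^ 2 * exp (Rabs z)) with (Rabs z ^ 1 * exp (Rabs z) * Rabs z) by ring.
    apply h.
    - intros t _; apply is_derive_Reals; auto_derive; [exact I|ring].
    - intros t Ht; eapply Rle_trans; [apply H1|apply Hmon; auto]. }
  assert (h := MVT_bound (fun t => exp t - (1 + t + t ^ 2 / 2))
                 (fun t => exp t - (1 + t)) 0 y (Rabs y ^ 2 * exp (Rabs y))).
  cbv beta in h; rewrite exp_0, Rminus_0_r in h.
  replace (exp y - (1 + y + y ^ 2 / 2) - (1 - (1 + 0 + 0 ^ 2 / 2)))
    with (exp y - (1 + y + y ^ 2 / 2)) in h by field.
  replace (Rabs y ^ 3 * exp (Rabs y)) with (Rabs y ^ 2 * exp (Rabs y) * Rabs y) by ring.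
  apply h.
  - intros t _; apply is_derive_Reals; auto_derive; [exact I|field].
  - intros t Ht; eapply Rle_trans; [apply H2|apply Hmon; auto].
Qed.

(** The exponential form is prescribed only near the origin; elsewhere boundedness suffices, because
    (I) and (III) make the contribution of large arguments negligible. The radius 1/2 is where
    [cutoff] starts to act. *)
Definition expands (G : R -> R) (a d : R) : Prop :=
  blip G /\ (forall u, 0 <= G u) /\
  (forall u, Rabs u <= 1 / 2 -> G u = exp (a * u + d * u ^ 2)).

Lemma expands_bound G a d : expands G a d ->
  exists C, 0 <= C /\ forall u,
    Rabs (G u - (1 + a * u + (a ^ 2 / 2 + d) * clamp 1 u ^ 2)) <= C * rmd u.
Proof.
  intros [[_ [B [B0 HB]]] [_ HG]].
  set (D := Rabs a + Rabs d).
  assert (D0 : 0 <= D) by (apply Rplus_le_le_0_compat; apply Rabs_pos).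
  set (k := a ^ 2 / 2 + d).
  (* Constant for |u| <= 1/2: the exponential remainder at y = a u + d u^2, where |y| <= D |u|, plus
     the terms a d u^3 + d^2 u^4 / 2 of y^2 / 2. *)
  set (C1 := D ^ 3 * exp D + (Rabs (a * d) + d ^ 2)).
  (* Constant for |u| > 1/2: all terms are bounded separately, using 1 <= 8 rmd(u) and |u| <= 4
     rmd(u). *)
  set (C2 := 8 * (B + 1 + Rabs k) + 4 * Rabs a).
  assert (C10 : 0 <= C1).
  { apply Rplus_le_le_0_compat.
    - apply Rmult_le_pos; [apply pow_le, D0|left; apply exp_pos].
    - apply Rplus_le_le_0_compat; [apply Rabs_pos|apply pow2_ge_0]. }
  assert (C20 : 0 <= C2) by (unfold C2; generalize (Rabs_pos k) (Rabs_pos a); lra).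
  exists (C1 + C2); split; [lra|]; intros u.
  assert (r0 := rmd_pos u).
  destruct (Rle_lt_dec (Rabs u) (1 / 2)) as [h|h].
  - apply Rle_trans with (C1 * rmd u); [|apply Rmult_le_compat_r; lra].
    rewrite HG, clamp_id, rmd_small by lra.
    set (y := a * u + d * u ^ 2).
    assert (Hy : Rabs y <= D * Rabs u).
    { unfold y, D; eapply Rle_trans; [apply Rabs_triang|].
      rewrite !Rabs_mult, <- RPow_abs, Rmult_plus_distr_r.
      apply Rplus_le_compat_l, Rmult_le_compat_l; [apply Rabs_pos|].
      clear - h; assert (h0 := Rabs_pos u); nra. }
    assert (Hy1 : Rabs y <= D).
    { eapply Rle_trans; [exact Hy|]; rewrite <- (Rmult_1_r D) at 2.
      apply Rmult_le_compat_l; lra. }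
    replace (exp y - (1 + a * u + k * u ^ 2))
      with ((exp y - (1 + y + y ^ 2 / 2)) + (a * d + d ^ 2 * u / 2) * u ^ 3)
      by (unfold y, k; field).
    eapply Rle_trans; [apply Rabs_triang|]; unfold C1; rewrite (Rmult_plus_distr_r (D ^ 3 * exp D)).
    apply Rplus_le_compat.
    + eapply Rle_trans; [apply exp_remainder|].
      apply Rle_trans with ((D * Rabs u) ^ 3 * exp D).
      * apply Rmult_le_compat; [apply pow_le, Rabs_pos|left; apply exp_pos| |].
        -- apply pow_incr; split; [apply Rabs_pos|exact Hy].
        -- apply exp_le, Hy1.
      * rewrite Rpow_mult_distr; right; ring.
    + rewrite Rabs_mult, <- RPow_abs; apply Rmult_le_compat_r; [apply pow_le, Rabs_pos|].
      eapply Rle_trans; [apply Rabs_triang|]; apply Rplus_le_compat_l.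
      replace (d ^ 2 * u / 2) with (d ^ 2 * (u / 2)) by field.
      rewrite Rabs_mult, (Rabs_pos_eq (d ^ 2)) by apply pow2_ge_0.
      assert (Rabs (u / 2) <= 1) by
        (unfold Rdiv; rewrite Rabs_mult, (Rabs_pos_eq (/ 2)) by lra; lra).
      rewrite <- (Rmult_1_r (d ^ 2)) at 2; apply Rmult_le_compat_l; [apply pow2_ge_0|assumption].
  - apply Rle_trans with (C2 * rmd u); [|apply Rmult_le_compat_r; lra].
    assert (h4 := rmd_big u ltac:(lra)).
    unfold Rminus; eapply Rle_trans; [apply Rabs_triang|]; rewrite Rabs_Ropp.
    assert (Rabs (1 + a * u + k * clamp 1 u ^ 2) <= 1 + Rabs a * Rabs u + Rabs k).
    { eapply Rle_trans; [apply Rabs_triang|]; apply Rplus_le_compat.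
      - eapply Rle_trans; [apply Rabs_triang|]; rewrite Rabs_R1, Rabs_mult; lra.
      - rewrite Rabs_mult, (Rabs_pos_eq (clamp 1 u ^ 2)) by apply pow2_ge_0.
        generalize (clamp_sq_le1 u) (Rabs_pos k); intros; nra. }
    specialize (HB u); unfold C2.
    generalize (Rabs_pos a) (Rabs_pos k); intros.
    assert (1 <= 8 * rmd u) by lra.
    assert (Rabs a * Rabs u <= Rabs a * (4 * rmd u)) by (apply Rmult_le_compat_l; lra).
    assert ((B + 1 + Rabs k) * 1 <= (B + 1 + Rabs k) * (8 * rmd u))
      by (apply Rmult_le_compat_l; lra).
    lra.
Qed.

Lemma blip_sq f : blip f -> blip (fun u => f u ^ 2).
Proof.
  intros Hf; apply (blip_mult _ _ Hf (blip_mult _ _ Hf (blip_const 1))).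
Qed.

Lemma blip_clamp_sq b : blip (fun u => clamp 1 (b * u) ^ 2).
Proof. apply blip_sq, blip_dil, blip_clamp; lra. Qed.

Lemma clamp_sq_diff s t : Rabs (clamp 1 s ^ 2 - clamp 1 t ^ 2) <= 2 * Rabs (s - t).
Proof.
  assert (H1 : forall v, Rabs (clamp 1 v) <= 1).
  { intros v; apply Rsqr_incr_0; [|apply Rabs_pos|lra].
    rewrite <- Rsqr_abs, Rsqr_1, Rsqr_pow2; apply clamp_sq_le1. }
  replace (clamp 1 s ^ 2 - clamp 1 t ^ 2)
    with ((clamp 1 s + clamp 1 t) * (clamp 1 s - clamp 1 t)) by ring.
  rewrite Rabs_mult; apply Rmult_le_compat; try apply Rabs_pos.
  - eapply Rle_trans; [apply Rabs_triang|]; generalize (H1 s) (H1 t); lra.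
  - unfold clamp; eapply Rle_trans; [apply Rabs_Rmax|apply Rabs_Rmin].
Qed.

Lemma clamp_sq_shrink eta t : 0 < eta <= 1 ->
  clamp 1 (t / eta) ^ 2 <= / eta ^ 2 * clamp 1 t ^ 2.
Proof.
  intros He; assert (0 < eta ^ 2 <= 1) by nra.
  assert (1 <= / eta ^ 2) by (rewrite <- Rinv_1 at 1; apply Rinv_le_contravar; lra).
  destruct (Rle_lt_dec (Rabs t) 1) as [h|h].
  - eapply Rle_trans; [apply clamp_sq_le|].
    rewrite clamp_id by exact h; right; field; lra.
  - rewrite (clamp_sq_big t) by lra; generalize (clamp_sq_le1 (t / eta)); lra.
Qed.

(** * Sub-linear functionals on Lipschitz functions *)

Definition lip_expectation (e : (R -> R) -> R) : Prop :=
  (forall f g, lip f -> lip g -> (forall u, f u <= g u) -> e f <= e g) /\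
  (forall c, e (fun _ => c) = c) /\
  (forall f g, lip f -> lip g -> e (fun u => f u + g u) <= e f + e g) /\
  (forall c f, lip f -> 0 <= c -> e (fun u => c * f u) = c * e f).

(* With b = 1/y this is y^-2 l(y) in the notation of the paper. *)
Definition pw (e : (R -> R) -> R) (b : R) : R := e (fun u => clamp 1 (b * u) ^ 2).

(** Condition (I) at y = 1/b, with the capacity replaced by test functions below the indicator of |b
    u| >= 1. Negative values of f are allowed, so that differences of truncations qualify. *)
Definition small_tail (e : (R -> R) -> R) : Prop :=
  forall eps, 0 < eps -> exists b0, 0 < b0 /\ forall b, 0 < b <= b0 ->
  forall f, lip f -> (forall u, Rabs (b * u) < 1 -> f u <= 0) ->
    (forall u, f u <= 1) -> e f <= eps * pw e b.

Definition unif_integrable (e : (R -> R) -> R) : Prop :=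
  forall eps, 0 < eps -> exists M, forall c, M <= c ->
    e (fun u => Rmax (Rabs u - c) 0) <= eps.

Section Functional.
Context (e : (R -> R) -> R) (He : lip_expectation e).

Lemma e_mono f g : lip f -> lip g -> (forall u, f u <= g u) -> e f <= e g.
Proof. apply He. Qed.

Lemma e_const c : e (fun _ => c) = c.
Proof. apply He. Qed.

Lemma e_plus f g : lip f -> lip g -> e (fun u => f u + g u) <= e f + e g.
Proof. apply He. Qed.

Lemma e_scal c f : lip f -> 0 <= c -> e (fun u => c * f u) = c * e f.
Proof. apply He. Qed.

Lemma e_ext f g : (forall u, f u = g u) -> e f = e g.
Proof. intros h; f_equal; apply functional_extensionality, h. Qed.

Lemma e_nonneg f : lip f -> (forall u, 0 <= f u) -> 0 <= e f.
Proof.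
  intros Hf H0; rewrite <- (e_const 0); apply e_mono; auto using lip_const.
Qed.

Lemma pw_nonneg b : 0 <= pw e b.
Proof. apply e_nonneg; [apply blip_clamp_sq|intros; apply pow2_ge_0]. Qed.

Lemma pw_0 : pw e 0 = 0.
Proof.
  unfold pw; rewrite (e_ext _ (fun _ => 0)); [apply e_const|].
  intros u; rewrite Rmult_0_l, clamp_id by (rewrite Rabs_R0; lra); ring.
Qed.

(** The truncated square is 2-Lipschitz in its argument, so p changes by at most 2 |b - c| E|X|.
    Continuity lets the intermediate value theorem solve n p(b) = x_n^2 exactly. *)
Lemma pw_continuous : continuity (pw e).
Proof.
  set (m := e Rabs).
  assert (labs : lip Rabs) by apply (lip_abs _ lip_id).
  assert (m0 : 0 <= m) by (apply e_nonneg; [exact labs|apply Rabs_pos]).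
  assert (Hle : forall b c, pw e b <= pw e c + 2 * Rabs (b - c) * m).
  { intros b c.
    assert (h0 : 0 <= 2 * Rabs (b - c)) by (generalize (Rabs_pos (b - c)); lra).
    unfold m; rewrite <- e_scal by assumption.
    assert (l1 := proj1 (blip_clamp_sq b)); assert (l2 := proj1 (blip_clamp_sq c)).
    assert (l3 := lip_scal (2 * Rabs (b - c)) _ labs).
    eapply Rle_trans; [|apply (e_plus _ _ l2 l3)].
    apply (e_mono _ _ l1 (lip_plus _ _ l2 l3)); intros u.
    assert (h := clamp_sq_diff (b * u) (c * u)).
    rewrite <- Rmult_minus_distr_r, Rabs_mult in h.
    apply Rabs_le_between in h; lra. }
  intros b eps Heps; exists (eps / (2 * m + 1)); split.
  - apply Rdiv_lt_0_compat; lra.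
  - intros c [_ Hc]; simpl in *; unfold R_dist in *.
    assert (h1 := Hle b c); assert (h2 := Hle c b); rewrite Rabs_minus_sym in h1.
    apply Rle_lt_trans with (2 * Rabs (c - b) * m); [apply Rabs_le; lra|].
    apply Rmult_lt_compat_r with (r := 2 * m + 1) in Hc; [|lra].
    unfold Rdiv in Hc; rewrite Rmult_assoc, Rinv_l, Rmult_1_r in Hc by lra.
    generalize (Rabs_pos (c - b)); lra.
Qed.

Lemma pw_reaches b1 y : 0 < b1 -> 0 < y <= pw e b1 ->
  exists b, 0 < b <= b1 /\ pw e b = y.
Proof.
  intros Hb Hy; destruct (IVT_gen (pw e) 0 b1 y pw_continuous) as [b [h1 h2]].
  - rewrite pw_0, Rmin_left, Rmax_right; lra.
  - rewrite Rmin_left, Rmax_right in h1 by lra.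
    exists b; split; [|exact h2]; split; [|apply h1].
    destruct (proj1 h1) as [h|h]; [exact h|].
    rewrite <- h, pw_0 in h2; lra.
Qed.

Context (Htail : small_tail e) (Hui : unif_integrable e).

Definition excess (b : R) : R := e (fun u => Rmax (Rabs (b * u) - 1) 0).

Lemma lip_excess b k : lip (fun u => Rmax (Rabs (b * u) - k) 0).
Proof.
  apply lip_max, lip_minus; [apply lip_abs, lip_scal, lip_id|apply lip_const].
Qed.

(* Dyadic summation: |u| - 1 <= 1 + 2 (|u/2| - 1)^+ on |u| >= 1, and slow variation
   gives p(b/2) <= p(b)/3, so the geometric series with ratio 2/3 converges. *)
Lemma excess_small eps : 0 < eps ->
  exists b0, 0 < b0 /\ forall b, 0 < b <= b0 -> excess b <= eps * pw e b.
Proof.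
  (* The value 1/9 makes 3/4 d + 1/4 <= 1/3, the ratio wanted for p(b/2) / p(b); the value eps/3
     pays for the sum 3 of the geometric series with ratio 2/3. *)
  intros Heps; set (d := Rmin (1 / 9) (eps / 3)).
  assert (Hd : 0 < d) by (apply Rmin_glb_lt; lra).
  destruct (Htail d Hd) as [b0 [Hb0 Ht]]; exists b0; split; [exact Hb0|].
  assert (d1 : d <= 1 / 9) by apply Rmin_l.
  assert (d2 : d <= eps / 3) by apply Rmin_r.
  assert (Hhalf : forall b, 0 < b <= b0 -> pw e (b / 2) <= pw e b / 3).
  { intros b Hb.
    assert (l1 := proj1 (blip_clamp_sq (b / 2))); assert (l2 := proj1 (blip_clamp_sq b)).
    (* Subtracting a quarter of the coarser truncation makes f <= 0 on |b u| < 1; what remains is at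
       most 3/4, whence the factor 4/3. *)
    set (f := fun u => 4 / 3 * (clamp 1 (b / 2 * u) ^ 2 - 1 / 4 * clamp 1 (b * u) ^ 2)).
    assert (lf : lip f).
    { apply lip_scal, lip_minus; [exact l1|apply lip_scal, l2]. }
    assert (h := Ht b Hb f lf).
    assert (Hf : e f <= d * pw e b).
    { apply h; intros u; unfold f.
      - intros hu; rewrite (clamp_id 1 (b * u)) by lra.
        assert (h1 := clamp_sq_le (b / 2 * u)).
        replace ((b / 2 * u) ^ 2) with (1 / 4 * (b * u) ^ 2) in h1 by field; lra.
      - assert (h1 := clamp_sq_le1 (b / 2 * u)).
        destruct (Rle_lt_dec (Rabs (b * u)) 1) as [hu|hu].
        + rewrite (clamp_id 1 (b * u)) by lra.
          assert (h2 := clamp_sq_le (b / 2 * u)).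
          replace ((b / 2 * u) ^ 2) with (1 / 4 * (b * u) ^ 2) in h2 by field; lra.
        + rewrite (clamp_sq_big (b * u)) by lra; lra. }
    apply Rle_trans with (3 / 4 * e f + 1 / 4 * pw e b).
    - unfold pw; rewrite <- !e_scal by (auto; lra).
      eapply Rle_trans; [|apply e_plus; apply lip_scal; assumption].
      apply e_mono; [exact l1|apply lip_plus; apply lip_scal; assumption|].
      intros u; unfold f; lra.
    - generalize (pw_nonneg b); intros; nra. }
  assert (Hrec : forall b, 0 < b <= b0 -> excess b <= d * pw e b + 2 * excess (b / 2)).
  { intros b Hb; assert (l1 := lip_excess b 1); assert (l2 := lip_excess b 2).
    assert (l3 := lip_excess (b / 2) 1).
    set (f := fun u => Rmax (Rabs (b * u) - 1) 0 - Rmax (Rabs (b * u) - 2) 0).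
    assert (lf : lip f) by (apply lip_minus; assumption).
    assert (Hf : e f <= d * pw e b).
    { apply (Ht b Hb f lf); intros u; unfold f.
      - intros hu; rewrite !Rmax_right; lra.
      - unfold Rmax; repeat destruct Rle_dec; lra. }
    apply Rle_trans with (e f + 2 * excess (b / 2)); [|lra].
    unfold excess; rewrite <- e_scal by (auto; lra).
    eapply Rle_trans; [|apply e_plus; [exact lf|apply lip_scal, l3]].
    apply e_mono; [exact l1|apply lip_plus; [exact lf|apply lip_scal, l3]|].
    intros u; unfold f.
    replace (b / 2 * u) with (b * u * / 2) by field.
    rewrite (Rabs_mult (b * u)), (Rabs_pos_eq (/ 2)) by lra.
    unfold Rmax; repeat destruct Rle_dec; lra. }
  assert (Hiter : forall k b, 0 < b <= b0 ->
            excess b <= 3 * d * pw e b + 2 ^ k * excess (b / 2 ^ k)).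
  { induction k as [|k IH]; intros b Hb.
    - simpl; replace (b / 1) with b by field.
      generalize (pw_nonneg b); intros; nra.
    - assert (h1 := Hrec b Hb); assert (h2 := Hhalf b Hb).
      assert (h3 := IH (b / 2) ltac:(lra)).
      replace (b / 2 ^ S k) with (b / 2 / 2 ^ k)
        by (simpl; field; apply pow_nonzero; lra).
      simpl; assert (0 < d) by lra; nra. }
  intros b Hb; apply Rle_trans with (3 * d * pw e b);
    [|apply Rmult_le_compat_r; [apply pw_nonneg|lra]].
  apply le_epsilon; intros z Hz.
  (* By scaling, the residual [2 ^ k * excess (b / 2 ^ k)] equals b e[(|u| - 2^k/b)^+], which
     uniform integrability makes at most z for large k. *)
  destruct (Hui (z / b)) as [M HM]; [apply Rdiv_lt_0_compat; lra|].
  destruct (Pow_x_infinity 2 ltac:(rewrite Rabs_pos_eq; lra) (M * b)) as [k Hk].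
  specialize (Hk k (Nat.le_refl k)).
  assert (p0 : 0 < 2 ^ k) by (apply pow_lt; lra).
  rewrite Rabs_pos_eq in Hk by lra.
  assert (hM : M <= 2 ^ k / b).
  { apply Rmult_le_reg_r with b; [lra|]; unfold Rdiv.
    rewrite Rmult_assoc, Rinv_l by lra; lra. }
  eapply Rle_trans; [apply (Hiter k b Hb)|]; apply Rplus_le_compat_l.
  replace (2 ^ k * excess (b / 2 ^ k))
    with (b * e (fun u => Rmax (Rabs u - 2 ^ k / b) 0)).
  - apply Rle_trans with (b * (z / b)); [apply Rmult_le_compat_l; [lra|auto]|].
    right; field; lra.
  - unfold excess; rewrite <- !e_scal; try lra; [|apply lip_excess|].
    + apply e_ext; intros u.
      rewrite <- !RmaxRmult by lra; rewrite !Rmult_0_r; f_equal.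
      rewrite !Rabs_mult, (Rabs_pos_eq (b / 2 ^ k))
        by (apply Rlt_le, Rdiv_lt_0_compat; lra).
      field; lra.
    + apply lip_max, lip_minus; [apply lip_abs, lip_id|apply lip_const].
Qed.

(** The cube is at most eta times the square on |b u| <= eta. Beyond eta, the tail condition is
    applied at scale b/eta; there p(b/eta) <= eta^-2 p(b), a loss compensated by the factor eta^2 in
    the chosen tolerance. The linear part is [excess]. *)
Lemma rmd_negligible eps : 0 < eps ->
  exists b0, 0 < b0 /\ forall b, 0 < b <= b0 ->
    e (fun u => rmd (b * u)) <= eps * pw e b.
Proof.
  intros Heps; set (eta := Rmin 1 (eps / 3)).
  assert (He1 : 0 < eta) by (apply Rmin_glb_lt; lra).
  assert (He2 : eta <= 1) by apply Rmin_l.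
  assert (He3 : eta <= eps / 3) by apply Rmin_r.
  assert (e2 : 0 < eta ^ 2) by (apply pow_lt, He1).
  destruct (Htail (eps / 3 * eta ^ 2)) as [b1 [Hb1 Ht]].
  { apply Rmult_lt_0_compat; lra. }
  destruct (excess_small (eps / 3)) as [b2 [Hb2 Hx]]; [lra|].
  exists (Rmin (eta * b1) b2); split.
  { apply Rmin_glb_lt; [apply Rmult_lt_0_compat|]; lra. }
  intros b [Hb Hbm].
  assert (h1 := Rle_trans _ _ _ Hbm (Rmin_l _ _)).
  assert (h2 := Rle_trans _ _ _ Hbm (Rmin_r _ _)).
  assert (Hbe : 0 < b / eta <= b1).
  { split; [apply Rdiv_lt_0_compat; lra|].
    apply Rmult_le_reg_r with eta; [lra|]; unfold Rdiv.
    rewrite Rmult_assoc, Rinv_l by lra; lra. }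
  assert (Hpe : pw e (b / eta) <= / eta ^ 2 * pw e b).
  { unfold pw; rewrite <- e_scal.
    - apply e_mono; [apply blip_clamp_sq|apply lip_scal, blip_clamp_sq|].
      intros u; replace (b / eta * u) with (b * u / eta) by (field; lra).
      apply clamp_sq_shrink; lra.
    - apply blip_clamp_sq.
    - left; apply Rinv_0_lt_compat, e2. }
  set (f := fun u => rmd (b * u) - Rmax (Rabs (b * u) - 1) 0 - eta * clamp 1 (b * u) ^ 2).
  assert (l1 := lip_dil b _ lip_rmd); assert (l2 := lip_excess b 1).
  assert (l3 := proj1 (blip_clamp_sq b)).
  assert (lf : lip f).
  { apply lip_minus; [apply lip_minus; assumption|apply lip_scal, l3]. }
  assert (Hf : e f <= eps / 3 * eta ^ 2 * pw e (b / eta)).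
  { apply (Ht _ Hbe f lf); intros u.
    - intros hu; replace (b / eta * u) with (b * u * / eta) in hu by (field; lra).
      rewrite Rabs_mult, (Rabs_pos_eq (/ eta)) in hu
        by (left; apply Rinv_0_lt_compat, He1).
      assert (hu' : Rabs (b * u) < eta).
      { apply Rmult_lt_reg_r with (/ eta); [apply Rinv_0_lt_compat, He1|].
        rewrite Rinv_r by lra; exact hu. }
      unfold f, rmd; rewrite !clamp_id by lra.
      rewrite <- (pow2_abs (b * u)).
      generalize (pow2_ge_0 (Rabs (b * u))); intros; nra.
    - unfold f, rmd; assert (h := clamp_sq_le1 (b * u)).
      rewrite <- pow2_abs in h |- *; generalize (Rabs_pos (clamp 1 (b * u))).
      intros; nra. }
  apply Rle_trans with (e f + (excess b + eta * pw e b)).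
  - unfold excess, pw; rewrite <- e_scal by (auto; lra).
    assert (l4 := lip_scal eta _ l3).
    eapply Rle_trans; [|apply Rplus_le_compat_l, (e_plus _ _ l2 l4)].
    eapply Rle_trans; [|apply (e_plus _ _ lf (lip_plus _ _ l2 l4))].
    apply e_mono; [exact l1|apply lip_plus; [exact lf|apply lip_plus; assumption]|].
    intros u; unfold f; lra.
  - assert (h3 := Hx b (conj Hb h2)); assert (p0 := pw_nonneg b).
    assert (h4 : eps / 3 * eta ^ 2 * pw e (b / eta) <= eps / 3 * pw e b).
    { rewrite Rmult_assoc; apply Rmult_le_compat_l; [lra|].
      apply Rle_trans with (eta ^ 2 * (/ eta ^ 2 * pw e b)).
      - apply Rmult_le_compat_l; lra.
      - right; field; lra. }
    assert (eta * pw e b <= eps / 3 * pw e b) by (apply Rmult_le_compat_r; lra).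
    lra.
Qed.

(** The second-moment term stays inside [e] because its coefficient may be negative, and then [e] of
    it is not the coefficient times p(b). Since a >= 0, the linear term contributes a b e(u) <=
    0. *)
Lemma expands_upper G a d eps :
  expands G a d -> 0 <= a -> e (fun u => u) <= 0 -> 0 < eps ->
  exists b0, 0 < b0 /\ forall b, 0 < b <= b0 ->
    e (fun u => G (b * u))
    <= 1 + e (fun u => (a ^ 2 / 2 + d) * clamp 1 (b * u) ^ 2) + eps * pw e b.
Proof.
  intros HG Ha Hm Heps; destruct (expands_bound _ _ _ HG) as [C [C0 HC]].
  destruct (rmd_negligible (eps / (C + 1))) as [b0 [Hb0 Hr]].
  { apply Rdiv_lt_0_compat; lra. }
  exists b0; split; [exact Hb0|]; intros b Hb; specialize (Hr b Hb).
  assert (lG := lip_dil b _ (proj1 (proj1 HG))).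
  assert (l1 := lip_scal (a * b) _ lip_id).
  assert (l2 := lip_scal (a ^ 2 / 2 + d) _ (proj1 (blip_clamp_sq b))).
  assert (l0 := lip_const 1).
  assert (l3 := lip_scal C _ (lip_dil b _ lip_rmd)).
  assert (l12 := lip_plus _ _ l0 (lip_plus _ _ l1 (lip_plus _ _ l2 l3))).
  eapply Rle_trans; [apply (e_mono _ _ lG l12)|].
  { intros u; assert (h := HC (b * u)); apply Rabs_le_between in h; lra. }
  eapply Rle_trans; [apply (e_plus _ _ l0), (lip_plus _ _ l1 (lip_plus _ _ l2 l3))|].
  eapply Rle_trans; [apply Rplus_le_compat_l, (e_plus _ _ l1 (lip_plus _ _ l2 l3))|].
  eapply Rle_trans; [apply Rplus_le_compat_l, Rplus_le_compat_l, (e_plus _ _ l2 l3)|].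
  rewrite e_const, (e_scal (a * b)) by (apply lip_id || (apply Rmult_le_pos; lra)).
  rewrite (e_scal C) by (exact C0 || apply (lip_dil b _ lip_rmd)).
  assert (a * b * e (fun u => u) <= 0).
  { assert (0 <= a * b) by (apply Rmult_le_pos; lra); nra. }
  assert (C * e (fun u => rmd (b * u)) <= eps * pw e b).
  { apply Rle_trans with ((C + 1) * (eps / (C + 1) * pw e b)).
    - apply Rmult_le_compat; try lra.
      apply e_nonneg; [apply (lip_dil b _ lip_rmd)|intros; apply rmd_pos].
    - right; field; lra. }
  lra.
Qed.

(** Sub-additivity bounds only from above, so the expansion is solved for its quadratic term: that
    term is at most G - 1 - a b u + C rmd pointwise, and applying [e] leaves e(G) as the only
    unknown. The mean enters through e(-u) <= 0. *)
Lemma expands_lower G a d eps :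
  expands G a d -> 0 <= a -> 0 <= a ^ 2 / 2 + d -> e (fun u => - u) <= 0 -> 0 < eps ->
  exists b0, 0 < b0 /\ forall b, 0 < b <= b0 ->
    1 + (a ^ 2 / 2 + d - eps) * pw e b <= e (fun u => G (b * u)).
Proof.
  intros HG Ha Hk Hm Heps; destruct (expands_bound _ _ _ HG) as [C [C0 HC]].
  destruct (rmd_negligible (eps / (C + 1))) as [b0 [Hb0 Hr]].
  { apply Rdiv_lt_0_compat; lra. }
  exists b0; split; [exact Hb0|]; intros b Hb; specialize (Hr b Hb).
  assert (lG := lip_dil b _ (proj1 (proj1 HG))).
  assert (l1 := lip_scal (a * b) _ (lip_opp _ lip_id)).
  assert (lc := proj1 (blip_clamp_sq b)).
  assert (l2 := lip_scal (a ^ 2 / 2 + d) _ lc).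
  assert (lm := lip_const (-1)).
  assert (l3 := lip_scal C _ (lip_dil b _ lip_rmd)).
  assert (Hs : (a ^ 2 / 2 + d) * pw e b
               <= e (fun u => G (b * u)) + (e (fun _ => -1) + (e (fun u => a * b * - u)
                  + e (fun u => C * rmd (b * u))))).
  { eapply Rle_trans; [|apply Rplus_le_compat_l, Rplus_le_compat_l, (e_plus _ _ l1 l3)].
    eapply Rle_trans; [|apply Rplus_le_compat_l, (e_plus _ _ lm (lip_plus _ _ l1 l3))].
    eapply Rle_trans; [|apply (e_plus _ _ lG (lip_plus _ _ lm (lip_plus _ _ l1 l3)))].
    unfold pw; rewrite <- (e_scal _ _ lc Hk).
    apply e_mono; [exact l2|apply lip_plus, lip_plus, lip_plus; assumption|].
    intros u; assert (h := HC (b * u)); apply Rabs_le_between in h; lra. }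
  rewrite e_const, (e_scal (a * b)) in Hs
    by (apply (lip_opp _ lip_id) || (apply Rmult_le_pos; lra)).
  rewrite (e_scal C) in Hs by (exact C0 || apply (lip_dil b _ lip_rmd)).
  assert (a * b * e (fun u => - u) <= 0).
  { assert (0 <= a * b) by (apply Rmult_le_pos; lra); nra. }
  assert (C * e (fun u => rmd (b * u)) <= eps * pw e b).
  { apply Rle_trans with ((C + 1) * (eps / (C + 1) * pw e b)).
    - apply Rmult_le_compat; try lra.
      apply e_nonneg; [apply (lip_dil b _ lip_rmd)|intros; apply rmd_pos].
    - right; field; lra. }
  change (e Ropp) with (e (fun u => - u)) in Hs; lra.
Qed.

End Functional.

(** * Products of independent variables and bounds on the capacity *)

Fixpoint pprod (f : nat -> R) (n : nat) : R :=
  match n with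
  | O => 1
  | S k => pprod f k * f k
  end.

Lemma pprod_ext f g n : (forall i, (i < n)%nat -> f i = g i) -> pprod f n = pprod g n.
Proof. induction n; intros h; simpl; [easy|rewrite IHn, h; auto]. Qed.

Lemma pprod_nonneg f n : (forall i, 0 <= f i) -> 0 <= pprod f n.
Proof. intros h; induction n; simpl; [lra|apply Rmult_le_pos; auto]. Qed.

Lemma nrm_nonneg n v : 0 <= nrm n v.
Proof. induction n; simpl; [lra|eapply Rle_trans; [exact IHn|apply Rmax_l]]. Qed.

Lemma ClLip_of_lip n phi K : 0 <= K ->
  (forall v u, Rabs (phi v - phi u) <= K * nrm n (vsub v u)) -> ClLip n phi.
Proof.
  intros K0 h; exists (K + 1), 0%nat; split; [lra|]; intros v u; simpl.
  eapply Rle_trans; [apply h|]; apply Rmult_le_compat_r; [apply nrm_nonneg|lra].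
Qed.

Lemma ClLip_comp f : lip f -> ClLip 1 (fun v => f (v 0%nat)).
Proof.
  intros [L [L0 HL]]; apply ClLip_of_lip with L; [exact L0|]; intros v u; simpl.
  rewrite Rmax_right by apply Rabs_pos; apply HL.
Qed.

(** Boundedness of g keeps the product globally Lipschitz, hence admissible in the definition of
    independence; the induction carries the bound B^n together with the Lipschitz constant. *)
Lemma ClLip_pprod g n : blip g -> ClLip n (fun v => pprod (fun i => g (v i)) n).
Proof.
  intros [[L [L0 HL]] [B [B0 HB]]].
  assert (h : exists K, 0 <= K /\ forall v u,
    Rabs (pprod (fun i => g (v i)) n - pprod (fun i => g (u i)) n)
      <= K * nrm n (vsub v u) /\ Rabs (pprod (fun i => g (v i)) n) <= B ^ n).
  { induction n as [|n [K [K0 IH]]].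
    - exists 0; split; [lra|]; intros v u; simpl.
      rewrite Rminus_diag, Rabs_R0, Rabs_R1; lra.
    - exists (K * B + B ^ n * L); split.
      { apply Rplus_le_le_0_compat; apply Rmult_le_pos; auto using pow_le. }
      intros v u; destruct (IH v u) as [h1 h2], (IH u v) as [_ h3]; simpl; split.
      + set (p := pprod (fun i => g (v i)) n) in *.
        set (q := pprod (fun i => g (u i)) n) in *.
        replace (p * g (v n) - q * g (u n))
          with ((p - q) * g (v n) + q * (g (v n) - g (u n))) by ring.
        eapply Rle_trans; [apply Rabs_triang|]; rewrite !Rabs_mult.
        set (m := Rmax (nrm n (vsub v u)) (Rabs (vsub v u n))).
        assert (m1 : nrm n (vsub v u) <= m) by apply Rmax_l.
        assert (m2 : Rabs (v n - u n) <= m) by apply (Rmax_r (nrm n (vsub v u))).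
        rewrite Rmult_plus_distr_r; apply Rplus_le_compat.
        * replace (K * B * m) with (K * m * B) by ring.
          apply Rmult_le_compat; auto using Rabs_pos.
          eapply Rle_trans; [exact h1|apply Rmult_le_compat_l; auto].
        * rewrite Rmult_assoc; apply Rmult_le_compat; auto using Rabs_pos.
          eapply Rle_trans; [apply HL|apply Rmult_le_compat_l; auto].
      + rewrite Rabs_mult, Rmult_comm; apply Rmult_le_compat; auto using Rabs_pos. }
  destruct h as [K [K0 HK]]; apply ClLip_of_lip with K; [exact K0|apply HK].
Qed.

Lemma Rbar_finite_between y a b :
  Rbar_le (Finite a) y -> Rbar_le y (Finite b) -> is_finite y.
Proof. destruct y; simpl; try easy. Qed.

Lemma psum_ext f g n : (forall i, (i < n)%nat -> f i = g i) -> psum f n = psum g n.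
Proof. induction n; intros h; simpl; [easy|rewrite IHn, h; auto]. Qed.

Lemma psum_le f g n : (forall i, f i <= g i) -> psum f n <= psum g n.
Proof. intros h; induction n; simpl; [lra|apply Rplus_le_compat; auto]. Qed.

Lemma psum_lin a c f g n :
  psum (fun i => a * f i + c * g i) n = a * psum f n + c * psum g n.
Proof. induction n; simpl; [ring|rewrite IHn; ring]. Qed.

Lemma psum_scal a f n : psum (fun i => a * f i) n = a * psum f n.
Proof. induction n; simpl; [ring|rewrite IHn; ring]. Qed.

Lemma psum_nonneg f n : (forall i, 0 <= f i) -> 0 <= psum f n.
Proof. intros h; induction n; simpl; [lra|apply Rplus_le_le_0_compat; auto]. Qed.

Lemma psum_ge_term f n i : (forall i, 0 <= f i) -> (i < n)%nat -> f i <= psum f n.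
Proof.
  intros h; induction n as [|n IH]; intros hi; [easy|]; simpl.
  assert (h1 := psum_nonneg f n h); assert (h2 := h n).
  destruct (Nat.eq_dec i n) as [->|hne]; [lra|].
  assert (f i <= psum f n) by (apply IH; lia); lra.
Qed.

Lemma pprod_exp f n : pprod (fun i => exp (f i)) n = exp (psum f n).
Proof.
  induction n; simpl; [symmetry; apply exp_0|rewrite IHn, <- exp_plus; reflexivity].
Qed.

Lemma pprod_mult f g n : pprod (fun i => f i * g i) n = pprod f n * pprod g n.
Proof. induction n; simpl; [ring|rewrite IHn; ring]. Qed.

Lemma pprod_zero f n i : (i < n)%nat -> f i = 0 -> pprod f n = 0.
Proof.
  induction n as [|n IH]; intros hi h; [easy|]; simpl.
  destruct (Nat.eq_dec i n) as [->|hne]; [rewrite h; ring|].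
  rewrite IH; [ring|lia|exact h].
Qed.

Lemma pprod_le_1 f n : (forall i, 0 <= f i <= 1) -> pprod f n <= 1.
Proof.
  intros h; induction n; simpl; [lra|].
  assert (0 <= pprod f n) by (apply pprod_nonneg; intros; apply h).
  generalize (h n); intros; nra.
Qed.

Lemma exp_pow_INR y n : exp y ^ n = exp (INR n * y).
Proof.
  induction n; [simpl; rewrite Rmult_0_l, exp_0; reflexivity|].
  rewrite S_INR; simpl; rewrite IHn, <- exp_plus; f_equal; ring.
Qed.

Lemma exp_ge_1 y : 0 <= y -> 1 <= exp y.
Proof. intros; rewrite <- exp_0; apply exp_le; assumption. Qed.

(** * Exponential weights *)

(** Clamping the argument makes the exponential bounded and Lipschitz; the level M is adapted to
    each use. *)
Definition quad_weight (a d M u : R) : R := exp (a * clamp M u + d * clamp M u ^ 2).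

(** Essentially counts the summands with |u| >= 1. Its expansion has a = d = 0, so even a large T
    costs only o(p(b)). *)
Definition tail_weight (T u : R) : R := exp (T * cutoff u).

(** Vanishes for |u| >= 1, so that wherever a product of these weights is nonzero no clamp is active
    and its exponent is exactly linear in the sums of u and u^2. *)
Definition local_weight (a d u : R) : R := quad_weight a d 1 u * (1 - cutoff u).

Lemma quad_weight_expands a d M : 1 / 2 <= M -> expands (quad_weight a d M) a d.
Proof.
  intros HM; split; [|split].
  - assert (hc := blip_clamp M ltac:(lra)).
    apply blip_exp, blip_plus; apply blip_mult; auto using blip_const, blip_sq.
  - intros u; left; apply exp_pos.
  - intros u hu; unfold quad_weight; rewrite clamp_id by lra; reflexivity.
Qed.

Lemma tail_weight_expands T : expands (tail_weight T) 0 0.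
Proof.
  split; [|split].
  - apply blip_exp, blip_mult; auto using blip_const, blip_cutoff.
  - intros u; left; apply exp_pos.
  - intros u hu; unfold tail_weight; rewrite cutoff_small by exact hu; f_equal; ring.
Qed.

Lemma local_weight_expands a d : expands (local_weight a d) a d.
Proof.
  destruct (quad_weight_expands a d 1 ltac:(lra)) as [h1 [h2 h3]]; split; [|split].
  - assert (hc : blip (fun u => 1 + -1 * cutoff u))
      by (apply blip_plus; [|apply blip_mult]; auto using blip_const, blip_cutoff).
    assert (heq : (fun u => quad_weight a d 1 u * (1 + -1 * cutoff u)) = local_weight a d)
      by (apply functional_extensionality; intros; unfold local_weight; ring).
    rewrite <- heq; exact (blip_mult _ _ h1 hc).
  - intros u; apply Rmult_le_pos; [apply h2|generalize (cutoff_range u); lra].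
  - intros u hu; unfold local_weight; rewrite h3, cutoff_small by exact hu; ring.
Qed.

(** Exponential Chebyshev inequality for the lower tail of the sum of squares; clamping only
    decreases the squares. *)
Lemma small_variance_weight (u : nat -> R) n x T delta :
  0 <= T -> psum (fun i => u i ^ 2) n <= delta * x ^ 2 ->
  1 <= exp (T * delta * x ^ 2) * pprod (fun i => quad_weight 0 (- T) 1 (u i)) n.
Proof.
  intros HT Hq; unfold quad_weight; rewrite pprod_exp, <- exp_plus; apply exp_ge_1.
  assert (h : psum (fun i => - T * u i ^ 2) n
              <= psum (fun i => 0 * clamp 1 (u i) + - T * clamp 1 (u i) ^ 2) n).
  { apply psum_le; intros i; assert (h := clamp_sq_le (u i)); nra. }
  rewrite psum_scal in h; nra.
Qed.

(* Outside [-1, 1] the cutoff equals 1; AM-GM bounds the sum of cutoff(u)|u| by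
   (2 r psi + q/(2 r))/2 with q = sum u^2 and r = sqrt q / x. *)
Lemma large_variance_weight (u : nat -> R) n x T r1 :
  0 < x -> 0 <= T -> 0 < r1 ->
  r1 * x <= sqrt (psum (fun i => u i ^ 2) n) ->
  x * sqrt (psum (fun i => u i ^ 2) n) <= psum u n ->
  1 <= exp (- (T / 4) * x ^ 2) * pprod (fun i => tail_weight T (u i)) n
       + exp (- (r1 / 2) * x ^ 2) * pprod (fun i => quad_weight 1 0 1 (u i)) n.
Proof.
  intros Hx HT Hr Hq Hs.
  unfold tail_weight, quad_weight; rewrite !pprod_exp, <- !exp_plus.
  set (q := psum (fun i => u i ^ 2) n) in *.
  assert (q0 : 0 <= q) by (apply psum_nonneg; intros; apply pow2_ge_0).
  assert (hq := sqrt_sqrt q q0).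
  set (v := sqrt q) in *.
  assert (v0 : 0 < v) by (assert (0 < r1 * x) by (apply Rmult_lt_0_compat; lra); lra).
  set (psi := psum (fun i => cutoff (u i)) n).
  (* With psi >= x^2/4 the tail weights suffice. Otherwise r psi and q/(4 r) are each at most x v /
     4, so the clamped sum keeps at least x v / 2 >= r1 x^2 / 2. *)
  destruct (Rle_lt_dec (x ^ 2 / 4) psi) as [h|h].
  - rewrite psum_scal; fold psi.
    assert (1 <= exp (- (T / 4) * x ^ 2 + T * psi)) by (apply exp_ge_1; nra).
    assert (h1 := exp_pos (- (r1 / 2) * x ^ 2
      + psum (fun i => 1 * clamp 1 (u i) + 0 * clamp 1 (u i) ^ 2) n)); lra.
  - set (r := v / x).
    assert (r0 : 0 < r) by (apply Rdiv_lt_0_compat; lra).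
    assert (hterm : forall t, t - (r * cutoff t + / (4 * r) * t ^ 2)
                      <= 1 * clamp 1 t + 0 * clamp 1 t ^ 2).
    { intros t; assert (hc := cutoff_range t).
      assert (ham : cutoff t * Rabs t <= r * cutoff t + / (4 * r) * t ^ 2).
      { assert (h4 : 0 < / (4 * r)) by (apply Rinv_0_lt_compat; lra).
        assert (hi : / (4 * r) * (2 * r * cutoff t - Rabs t) ^ 2
                     = r * cutoff t ^ 2 - cutoff t * Rabs t + / (4 * r) * t ^ 2).
        { rewrite <- (pow2_abs t); field; lra. }
        assert (0 <= / (4 * r) * (2 * r * cutoff t - Rabs t) ^ 2)
          by (apply Rmult_le_pos; [lra|apply pow2_ge_0]).
        assert (cutoff t ^ 2 <= cutoff t) by nra.
        assert (r * cutoff t ^ 2 <= r * cutoff t) by (apply Rmult_le_compat_l; lra).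
        lra. }
      destruct (Rle_lt_dec (Rabs t) 1) as [ht|ht].
      - rewrite clamp_id by exact ht.
        assert (0 <= cutoff t * Rabs t) by (apply Rmult_le_pos; [lra|apply Rabs_pos]); lra.
      - rewrite cutoff_big in * by lra.
        assert (hb := proj2 (blip_clamp 1 ltac:(lra))).
        unfold clamp, Rmax, Rmin, Rabs in *; destruct (Rcase_abs t), (Rle_dec t 1);
          match goal with |- context [Rle_dec ?a ?b] => destruct (Rle_dec a b) end; lra. }
    assert (hsum := psum_le _ _ n (fun i => hterm (u i))).
    replace (psum (fun i => u i - (r * cutoff (u i) + / (4 * r) * u i ^ 2)) n)
      with (psum u n - (r * psi + / (4 * r) * q)) in hsum.
    2:{ unfold psi, q; generalize r; clear; intros r; induction n; cbn [psum]; [ring|rewrite <- IHn; ring]. }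
    assert (hrv : r * psi + / (4 * r) * q <= x * v / 2).
    { replace (/ (4 * r) * q) with (x * v / 4) by (rewrite <- hq; unfold r; field; lra).
      assert (r * psi <= r * (x ^ 2 / 4)) by (apply Rmult_le_compat_l; lra).
      replace (r * (x ^ 2 / 4)) with (x * v / 4) in * by (unfold r; field; lra); lra. }
    assert (1 <= exp (- (r1 / 2) * x ^ 2
      + psum (fun i => 1 * clamp 1 (u i) + 0 * clamp 1 (u i) ^ 2) n)).
    { apply exp_ge_1; assert (x * (r1 * x) <= x * v) by (apply Rmult_le_compat_l; lra); nra. }
    assert (h1 := exp_pos (- (T / 4) * x ^ 2 + psum (fun i => T * cutoff (u i)) n)); lra.
Qed.

(* t u - t^2 u^2 / 2 is maximal at u = 1/t, so clamping at M >= 1/t increases it. *)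
Lemma clamp_parabola t M u : 0 < t -> 1 <= t * M -> 
  t * u - t ^ 2 / 2 * u ^ 2 <= t * clamp M u + - (t ^ 2 / 2) * clamp M u ^ 2.
Proof.
  intros Ht HM; assert (M0 : 0 < M) by nra.
  assert (h : forall c, 0 <= (c - u) * (1 - t * (c + u) / 2) ->
            t * u - t ^ 2 / 2 * u ^ 2 <= t * c + - (t ^ 2 / 2) * c ^ 2).
  { intros c hc; assert (0 <= t * ((c - u) * (1 - t * (c + u) / 2)))
      by (apply Rmult_le_pos; lra); lra. }
  apply h; unfold clamp.
  destruct (Rle_lt_dec u M) as [h1|h1].
  - rewrite Rmin_left by exact h1; destruct (Rle_lt_dec (- M) u) as [h2|h2].
    + rewrite Rmax_left by exact h2; lra.
    + rewrite Rmax_right by lra; apply Rmult_le_pos; [lra|nra].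
  - rewrite Rmin_right, Rmax_left by lra.
    assert (t * M <= t * u) by (apply Rmult_le_compat_l; lra); nra.
Qed.

(** With s the sum, v^2 the sum of squares and s >= x v, completing the square gives t s - t^2 v^2 /
    2 >= x^2/2 - (t v - x)^2 / 2, and t v - x lies between 0 and eta x. *)
Lemma mid_variance_weight (u : nat -> R) n x t eta M :
  0 < x -> 0 < t -> 1 <= t * M -> 0 <= eta ->
  x <= t * sqrt (psum (fun i => u i ^ 2) n) <= (1 + eta) * x ->
  x * sqrt (psum (fun i => u i ^ 2) n) <= psum u n ->
  1 <= exp (- ((1 - eta ^ 2) / 2) * x ^ 2)
       * pprod (fun i => quad_weight t (- (t ^ 2 / 2)) M (u i)) n.
Proof.
  intros Hx Ht HM Heta Hq Hs.
  unfold quad_weight; rewrite pprod_exp, <- exp_plus; apply exp_ge_1.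
  assert (h := psum_le _ _ n (fun i => clamp_parabola t M (u i) Ht HM)).
  replace (psum (fun i => t * u i - t ^ 2 / 2 * u i ^ 2) n)
    with (t * psum u n - t ^ 2 / 2 * psum (fun i => u i ^ 2) n) in h.
  2:{ clear; induction n; cbn [psum]; [ring|rewrite <- IHn; ring]. }
  set (q := psum (fun i => u i ^ 2) n) in *.
  assert (q0 : 0 <= q) by (apply psum_nonneg; intros; apply pow2_ge_0).
  assert (hq := sqrt_sqrt q q0); set (v := sqrt q) in *.
  assert (t * (x * v) <= t * psum u n) by (apply Rmult_le_compat_l; lra).
  assert ((t * v - x) ^ 2 <= (eta * x) ^ 2) by (apply pow_incr; lra).
  assert (t ^ 2 / 2 * q = (t * v) ^ 2 / 2) by (rewrite <- hq; field).
  nra.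
Qed.

(* The tilted laws concentrate near (sum u, sum u^2) = (lam x^2, x^2) with lam = 1 + 2 d,
   an interior point of the event; the three subtracted weights dominate away from it. *)
Lemma lower_weight (u : nat -> R) n x d :
  0 < x -> 0 < d ->
  let lam := 1 + 2 * d in
  let k := lam * (lam + d) in
  let W := exp (- (k + d * (lam + d)) * x ^ 2)
             * pprod (fun i => local_weight (lam + d) 0 (u i)) n
         + (exp (- (k + d * (1 + d)) * x ^ 2)
             * pprod (fun i => local_weight lam d (u i)) n
         + exp (- (k - d * (lam - d)) * x ^ 2)
             * pprod (fun i => local_weight (lam - d) 0 (u i)) n) in
  let U := exp (- k * x ^ 2) * pprod (fun i => local_weight lam 0 (u i)) n in
  U <= 1 + W /\ (psum u n < x * sqrt (psum (fun i => u i ^ 2) n) -> U <= W).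
Proof.
  intros Hx Hd lam k W U.
  assert (Hf : forall a c, pprod (fun i => local_weight a c (u i)) n
    = exp (psum (fun i => a * clamp 1 (u i) + c * clamp 1 (u i) ^ 2) n)
      * pprod (fun i => 1 - cutoff (u i)) n).
  { intros a c; unfold local_weight, quad_weight; rewrite pprod_mult, pprod_exp; reflexivity. }
  unfold U, W; rewrite !Hf; clear U W.
  assert (P0 : 0 <= pprod (fun i => 1 - cutoff (u i)) n)
    by (apply pprod_nonneg; intros i; generalize (cutoff_range (u i)); lra).
  assert (P1 : pprod (fun i => 1 - cutoff (u i)) n <= 1)
    by (apply pprod_le_1; intros i; generalize (cutoff_range (u i)); lra).
  destruct (classic (exists i, (i < n)%nat /\ 1 <= Rabs (u i))) as [[i [hi h1]]|hno].
  { rewrite (pprod_zero _ n i hi) by (rewrite cutoff_big by exact h1; ring); lra. }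
  set (P := pprod (fun i => 1 - cutoff (u i)) n) in *.
  assert (Hs : forall a c, psum (fun i => a * clamp 1 (u i) + c * clamp 1 (u i) ^ 2) n
    = a * psum u n + c * psum (fun i => u i ^ 2) n).
  { intros a c; rewrite <- psum_lin; apply psum_ext; intros i hi.
    rewrite clamp_id; [reflexivity|].
    destruct (Rle_lt_dec 1 (Rabs (u i))); [exfalso; eauto|lra]. }
  rewrite !Hs; clear Hf Hs hno.
  set (q := psum (fun i => u i ^ 2) n).
  assert (q0 : 0 <= q) by (apply psum_nonneg; intros; apply pow2_ge_0).
  set (s := psum u n).
  set (z := x ^ 2); assert (z0 : 0 < z) by (apply pow_lt, Hx).
  set (y1 := exp (- (k + d * (lam + d)) * z) * (exp ((lam + d) * s + 0 * q) * P)).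
  set (y2 := exp (- (k + d * (1 + d)) * z) * (exp (lam * s + d * q) * P)).
  set (y3 := exp (- (k - d * (lam - d)) * z) * (exp ((lam - d) * s + 0 * q) * P)).
  assert (hpos : forall a c, 0 <= exp a * (exp c * P))
    by (intros; apply Rmult_le_pos; [|apply Rmult_le_pos]; auto; left; apply exp_pos).
  assert (hy1 : 0 <= y1) by apply hpos; assert (hy2 : 0 <= y2) by apply hpos.
  assert (hy3 : 0 <= y3) by apply hpos.
  assert (hcmp : forall a c a' c', a + c <= a' + c' ->
            exp a * (exp c * P) <= exp a' * (exp c' * P)).
  { intros; rewrite <- !Rmult_assoc, <- !exp_plus.
    apply Rmult_le_compat_r; [exact P0|apply exp_le; assumption]. }
  set (y := exp (- k * z) * (exp (lam * s + 0 * q) * P)).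
  (* Each neighbour differs from the main tilt by a factor exp(d (s - (lam + d) z)), exp(d (q - (1 +
     d) z)) or exp(d ((lam - d) z - s)), so it dominates exactly on its side of the threshold. *)
  destruct (Rle_lt_dec ((lam + d) * z) s) as [h1|h1].
  { assert (y <= y1) by (apply hcmp; nra); lra. }
  destruct (Rle_lt_dec ((1 + d) * z) q) as [h2|h2].
  { assert (y <= y2) by (apply hcmp; nra); lra. }
  destruct (Rle_lt_dec s ((lam - d) * z)) as [h3|h3].
  { assert (y <= y3) by (apply hcmp; nra); lra. }
  assert (hlam : 0 < lam) by (unfold lam; lra).
  split.
  - assert (y <= 1).
    { unfold y; rewrite <- Rmult_assoc, <- exp_plus.
      apply Rle_trans with (1 * 1); [|lra].
      apply Rmult_le_compat; auto; [left; apply exp_pos|].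
      rewrite <- exp_0; apply exp_le; unfold k; nra. }
    lra.
  (* In the remaining region s > (lam - d) z, and lam - d = 1 + d: this exceeds x sqrt q because q <
     (1 + d) z. *)
  - intros hlt; exfalso.
    assert (hv : x * sqrt q <= (1 + d) * z).
    { assert (sqrt q <= (1 + d) * x).
      { apply Rle_trans with (sqrt (((1 + d) * x) ^ 2)).
        - apply sqrt_le_1_alt; unfold z in *; nra.
        - rewrite sqrt_pow2; [lra|apply Rmult_le_pos; lra]. }
      unfold z; nra. }
    unfold lam in *; lra.
Qed.

Lemma geometric_grid r0 eta r J : 0 < eta -> r0 <= r < r0 * (1 + eta) ^ J ->
  exists j, (j < J)%nat /\ r0 * (1 + eta) ^ j <= r < r0 * (1 + eta) ^ S j.
Proof.
  intros Heta; induction J as [|J IH]; intros Hr; [simpl in Hr; lra|].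
  destruct (Rle_lt_dec (r0 * (1 + eta) ^ J) r) as [h|h].
  - exists J; split; [lia|lra].
  - destruct (IH ltac:(lra)) as [j [h1 h2]]; exists j; split; [lia|exact h2].
Qed.

Lemma pow_le_exp m k p n z : 0 <= m <= 1 + k * p -> INR n * p = z ->
  m ^ n <= exp (k * z).
Proof.
  intros hm hz; apply Rle_trans with (exp (k * p) ^ n).
  - apply pow_incr; split; [lra|]; eapply Rle_trans; [apply hm|apply exp_ineq1_le].
  - rewrite exp_pow_INR; right; f_equal; rewrite <- hz; ring.
Qed.

(** From 1 + y >= exp(y / (1 + y)) >= exp(y - y^2) with y = k p: over n factors the quadratic loss
    is k^2 p z, which is small relative to z only if p is small. *)
Lemma exp_le_pow m k p n z eps : 0 <= k -> 0 <= p -> k ^ 2 * p <= eps ->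
  1 + k * p <= m -> INR n * p = z -> exp ((k - eps) * z) <= m ^ n.
Proof.
  intros hk hp he hm hz.
  set (y := k * p); assert (y0 : 0 <= y) by (apply Rmult_le_pos; assumption).
  assert (hy : exp (y - y ^ 2) <= 1 + y).
  { apply Rle_trans with (exp (y / (1 + y))).
    - apply exp_le, Rmult_le_reg_r with (1 + y); [lra|].
      unfold Rdiv; rewrite Rmult_assoc, Rinv_l by lra.
      assert (0 <= y ^ 3) by (apply pow_le, y0); lra.
    - assert (h := exp_ineq1_le (- (y / (1 + y)))); rewrite exp_Ropp in h.
      assert (h0 := exp_pos (y / (1 + y))).
      apply Rmult_le_compat_r with (r := exp (y / (1 + y)) * (1 + y)) in h;
        [|apply Rmult_le_pos; lra].
      replace ((1 + - (y / (1 + y))) * (exp (y / (1 + y)) * (1 + y)))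
        with (exp (y / (1 + y))) in h by (field; lra).
      replace (/ exp (y / (1 + y)) * (exp (y / (1 + y)) * (1 + y)))
        with (1 + y) in h by (field; lra).
      exact h. }
  apply Rle_trans with (exp (y - y ^ 2) ^ n).
  - rewrite exp_pow_INR; apply exp_le.
    assert (hn := pos_INR n).
    replace (INR n * (y - y ^ 2)) with ((k - k ^ 2 * p) * (INR n * p))
      by (unfold y; ring).
    rewrite hz; apply Rmult_le_compat_r; [|lra].
    rewrite <- hz; apply Rmult_le_pos; assumption.
  - apply pow_incr; split; [left; apply exp_pos|]; fold y in hm; lra.
Qed.

(** * Capacity bounds from pointwise comparison *)

Section Space.
Context (Omega : Type) (H : (Omega -> R) -> Prop) (E : (Omega -> R) -> Rbar)
  (HE : sublinear_space H E).

Lemma H_plus Y Z : H Y -> H Z -> H (fun w => Y w + Z w).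
Proof. apply HE. Qed.

Lemma H_scal c Y : H Y -> H (fun w => c * Y w).
Proof. apply HE. Qed.

Lemma H_ClLip n (Yv : nat -> Omega -> R) phi :
  (forall i, H (Yv i)) -> ClLip n phi -> H (fun w => phi (fun j => Yv j w)).
Proof. intros HY Hp; apply HE with (n := n); auto. Qed.

Lemma H_lip f Y : lip f -> H Y -> H (fun w => f (Y w)).
Proof.
  intros Hf HY; apply (H_ClLip 1 (fun _ => Y) (fun v => f (v 0%nat)));
    auto using ClLip_comp.
Qed.

Lemma H_const (c : R) Y : H Y -> H (fun _ => c).
Proof. apply (H_lip (fun _ => c)), lip_const. Qed.

Lemma E_mono Y Z : H Y -> H Z -> (forall w, Y w <= Z w) -> Rbar_le (E Y) (E Z).
Proof. apply HE. Qed.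

Lemma E_const c : E (fun _ => c) = Finite c.
Proof. apply HE. Qed.

(** Finite upper bounds on both expectations exclude the undefined sum of opposite infinities. *)
Lemma E_plus_le Y Z a b : H Y -> H Z ->
  Rbar_le (E Y) (Finite a) -> Rbar_le (E Z) (Finite b) ->
  Rbar_le (E (fun w => Y w + Z w)) (Finite (a + b)).
Proof.
  intros HY HZ h1 h2.
  destruct HE as [_ [_ [_ [_ [_ [Hadd _]]]]]].
  assert (Hx : ex_Rbar_plus (E Y) (E Z)) by (destruct (E Y), (E Z); easy).
  eapply Rbar_le_trans; [apply (Hadd Y Z HY HZ Hx)|].
  destruct (E Y), (E Z); simpl in *; lra || easy.
Qed.

Lemma E_scal_pos l Y y : H Y -> E Y = Finite y -> 0 <= l ->
  E (fun w => l * Y w) = Finite (l * y).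
Proof.
  intros HY Hy [h|h].
  - destruct HE as [_ [_ [_ [_ [_ [_ Hs]]]]]].
    rewrite (Hs l Y HY h), Hy; reflexivity.
  - subst l; rewrite Rmult_0_l, <- E_const; f_equal.
    apply functional_extensionality; intros; ring.
Qed.

(** The value minus infinity is excluded by 0 = E[Y - Y] <= E[Y] + E[-Y]. *)
Lemma E_finite Y a b : H Y -> Rbar_le (E Y) (Finite a) ->
  Rbar_le (E (fun w => - Y w)) (Finite b) -> is_finite (E Y).
Proof.
  intros HY h1 h2; apply Rbar_finite_between with (- b) a; [|exact h1].
  assert (HN : H (fun w => - Y w)).
  { apply (H_lip _ _ (lip_opp _ lip_id) HY). }
  destruct HE as [_ [_ [_ [_ [Hc [Hadd _]]]]]].
  assert (Hx : ex_Rbar_plus (E Y) (E (fun w => - Y w)))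
    by (destruct (E Y), (E (fun w => - Y w)); easy).
  assert (h := Hadd _ _ HY HN Hx); cbv beta in h.
  replace (fun w => Y w + - Y w) with (fun _ : Omega => 0) in h
    by (apply functional_extensionality; intros; ring).
  rewrite Hc in h.
  destruct (E Y), (E (fun w => - Y w)); simpl in *; lra || easy.
Qed.

Lemma E_lip_finite f Y m : H Y -> Rbar_le (E (fun w => Rabs (Y w))) (Finite m) ->
  lip f -> is_finite (E (fun w => f (Y w))).
Proof.
  intros HY Hm Hf.
  assert (HA := H_lip _ _ (lip_abs _ lip_id) HY); cbv beta in HA.
  assert (Hup : forall g, lip g -> exists a, Rbar_le (E (fun w => g (Y w))) (Finite a)).
  { intros g Hg; assert (Hg' := Hg); destruct Hg as [L [L0 HL]].
    assert (fA : is_finite (E (fun w => Rabs (Y w)))).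
    { apply Rbar_finite_between with 0 m; [|exact Hm].
      rewrite <- E_const; apply E_mono; [apply (H_const 0 _ HY)|exact HA|].
      intros; apply Rabs_pos. }
    exists (g 0 + L * real (E (fun w => Rabs (Y w)))).
    apply Rbar_le_trans with (E (fun w => g 0 + L * Rabs (Y w))).
    - apply E_mono; [apply H_lip; assumption|
        apply H_plus; [apply (H_const _ _ HY)|apply H_scal, HA]|].
      intros w; assert (h := HL (Y w) 0); rewrite Rminus_0_r in h.
      apply Rabs_le_between in h; lra.
    - apply E_plus_le; [apply (H_const _ _ HY)|apply H_scal, HA| |].
      + rewrite E_const; apply Rbar_le_refl.
      + rewrite (E_scal_pos L _ (real (E (fun w => Rabs (Y w))))); auto.
        apply Rbar_le_refl. }
  destruct (Hup f Hf) as [a Ha], (Hup _ (lip_opp _ Hf)) as [b Hb].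
  apply E_finite with a b; auto using H_lip.
Qed.

Lemma is_glb_Vcap A : is_glb_Rbar (fun r : R => exists xi, H xi /\
     (forall w, 0 <= xi w /\ (A w -> 1 <= xi w)) /\ E xi = Finite r) (Vcap H E A).
Proof. apply Glb_Rbar_correct. Qed.

Lemma Vcap_ge A l :
  (forall xi r, H xi -> (forall w, 0 <= xi w) -> (forall w, A w -> 1 <= xi w) ->
     E xi = Finite r -> l <= r) ->
  Rbar_le (Finite l) (Vcap H E A).
Proof.
  intros h; apply (proj2 (is_glb_Vcap A)).
  intros r [xi [h1 [h2 h3]]]; apply (h xi r h1); auto; intros w; apply h2.
Qed.

(** The candidates for the infimum defining [Vcap], apart from domination of the event; this form is
    stable under sums. *)
Definition majorized (U : Omega -> R) (r : R) : Prop :=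
  H U /\ (forall w, 0 <= U w) /\ exists s, E U = Finite s /\ s <= r.

Lemma majorized_plus U W r s :
  majorized U r -> majorized W s -> majorized (fun w => U w + W w) (r + s).
Proof.
  intros [h1 [h2 [a [h3 h4]]]] [k1 [k2 [b [k3 k4]]]].
  assert (HUW := H_plus _ _ h1 k1).
  assert (h0 : forall w, 0 <= U w + W w) by (intros w; generalize (h2 w) (k2 w); lra).
  split; [exact HUW|split; [exact h0|]].
  assert (hE : Rbar_le (E (fun w => U w + W w)) (Finite (a + b)))
    by (apply E_plus_le; auto; [rewrite h3|rewrite k3]; apply Rbar_le_refl).
  assert (hL : Rbar_le (Finite 0) (E (fun w => U w + W w))).
  { rewrite <- E_const; apply E_mono; auto; apply (H_const 0 _ h1). }
  exists (real (E (fun w => U w + W w))).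
  assert (hf := Rbar_finite_between _ _ _ hL hE); split; [symmetry; exact hf|].
  rewrite <- hf in hE; simpl in hE; lra.
Qed.

Lemma majorized_psum (U : nat -> Omega -> R) r J X : H X ->
  (forall j, (j < J)%nat -> majorized (U j) r) ->
  majorized (fun w => psum (fun j => U j w) J) (INR J * r).
Proof.
  intros HX; induction J as [|J IH]; intros h.
  - simpl; split; [apply (H_const 0 _ HX)|split; [intros; lra|]].
    exists 0; split; [apply E_const|lra].
  - rewrite S_INR, Rmult_plus_distr_r, Rmult_1_l; simpl.
    apply majorized_plus; auto.
Qed.

Lemma Vcap_upper A U r : majorized U r -> (forall w, A w -> 1 <= U w) ->
  Rbar_le (Vcap H E A) (Finite r).
Proof.
  intros [h1 [h2 [s [h3 h4]]]] h.
  apply Rbar_le_trans with (Finite s); [|exact h4].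
  apply (proj1 (is_glb_Vcap A)); exists U; auto.
Qed.

Lemma Vcap_lower A U W s r : H U -> E U = Finite s -> majorized W r ->
  (forall w, A w -> U w <= 1 + W w) -> (forall w, ~ A w -> U w <= W w) ->
  Rbar_le (Finite (s - r)) (Vcap H E A).
Proof.
  intros HU hs [h1 [h2 [a [h3 h4]]]] hA hN.
  apply Vcap_ge; intros xi l Hxi h0 h5 h6.
  assert (hle : Rbar_le (E U) (E (fun w => xi w + W w))).
  { apply E_mono; [exact HU|apply H_plus; assumption|]; intros w.
    destruct (classic (A w)) as [h|h].
    - generalize (hA w h) (h5 w h); lra.
    - generalize (hN w h) (h0 w); lra. }
  assert (hadd : Rbar_le (E (fun w => xi w + W w)) (Finite (l + a)))
    by (apply E_plus_le; auto; [rewrite h6|rewrite h3]; apply Rbar_le_refl).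
  assert (hf := Rbar_le_trans _ _ _ hle hadd); rewrite hs in hf; simpl in hf; lra.
Qed.

Context (X : Omega -> R) (HX : H X).

Lemma Vcap_finite A : 0 <= real (Vcap H E A) <= 1 /\ is_finite (Vcap H E A).
Proof.
  assert (h0 : Rbar_le (Finite 0) (Vcap H E A)).
  { apply Vcap_ge; intros xi r h1 h2 _ h3.
    assert (h : Rbar_le (E (fun _ => 0)) (E xi))
      by (apply E_mono; auto; apply (H_const 0 _ HX)).
    rewrite E_const, h3 in h; exact h. }
  assert (h1 : Rbar_le (Vcap H E A) (Finite 1)).
  { apply Vcap_upper with (fun _ => 1); [|intros; lra].
    split; [apply (H_const 1 _ HX)|split; [intros; lra|]].
    exists 1; split; [apply E_const|lra]. }
  assert (hf := Rbar_finite_between _ _ _ h0 h1); split; [|exact hf].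
  rewrite <- hf in h0, h1; split; assumption.
Qed.

(** * The law of X as a real functional on Lipschitz functions *)

Definition lip_mean (f : R -> R) : R := real (E (fun w => f (X w))).

Context (HIII : forall eps : R, 0 < eps -> exists M : R, forall c : R, M <= c ->
     Rbar_le (E (fun w => Rmax (Rabs (X w) - c) 0)) (Finite eps)).

(** Since |X| <= M + (|X| - M)^+, condition (III) bounds E|X|, and Lipschitz functions grow at most
    linearly. Hence the default value of [real] at infinity never enters. *)
Lemma lip_mean_finite f : lip f -> E (fun w => f (X w)) = Finite (lip_mean f).
Proof.
  intros Hf; destruct (HIII 1) as [M HM]; [lra|]; specialize (HM M (Rle_refl M)).
  assert (HA := H_lip _ _ (lip_abs _ lip_id) HX); cbv beta in HA.
  assert (HZ : H (fun w => Rmax (Rabs (X w) - M) 0)).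
  { apply (H_lip (fun u => Rmax (Rabs u - M) 0)); [|exact HX].
    apply lip_max, lip_minus; [apply lip_abs, lip_id|apply lip_const]. }
  symmetry; apply (E_lip_finite f X (M + 1) HX); [|exact Hf].
  apply Rbar_le_trans with (E (fun w => M + Rmax (Rabs (X w) - M) 0)).
  - apply E_mono; [exact HA|apply H_plus; [apply (H_const _ _ HX)|exact HZ]|].
    intros w; generalize (Rmax_l (Rabs (X w) - M) 0); lra.
  - apply E_plus_le; [apply (H_const _ _ HX)|exact HZ| |exact HM].
    rewrite E_const; apply Rbar_le_refl.
Qed.

Lemma lip_mean_expectation : lip_expectation lip_mean.
Proof.
  split; [|split; [|split]].
  - intros f g Hf Hg h.
    assert (hle : Rbar_le (E (fun w => f (X w))) (E (fun w => g (X w))))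
      by (apply E_mono; auto using H_lip).
    rewrite !lip_mean_finite in hle by assumption; exact hle.
  - intros c; unfold lip_mean; rewrite E_const; reflexivity.
  - intros f g Hf Hg.
    assert (hle : Rbar_le (E (fun w => f (X w) + g (X w))) (lip_mean f + lip_mean g)).
    { apply E_plus_le; auto using H_lip; rewrite lip_mean_finite by assumption;
        apply Rbar_le_refl. }
    rewrite (lip_mean_finite _ (lip_plus _ _ Hf Hg)) in hle; exact hle.
  - intros c f Hf Hc; unfold lip_mean.
    rewrite (E_scal_pos c _ (lip_mean f)); auto using H_lip, lip_mean_finite.
Qed.

Lemma lip_mean_ui : unif_integrable lip_mean.
Proof.
  intros eps Heps; destruct (HIII eps Heps) as [M HM]; exists M; intros c Hc.
  specialize (HM c Hc).
  rewrite (lip_mean_finite (fun u => Rmax (Rabs u - c) 0)) in HM; [exact HM|].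
  apply lip_max, lip_minus; [apply lip_abs, lip_id|apply lip_const].
Qed.

Lemma Rmin_sq y v : 0 < y -> Rmin (v ^ 2) (y ^ 2) = y ^ 2 * clamp 1 (/ y * v) ^ 2.
Proof.
  intros Hy; assert (hy := Rinv_0_lt_compat y Hy).
  assert (y2 : 0 < y ^ 2) by (apply pow_lt, Hy).
  assert (hv : y ^ 2 * (/ y * v) ^ 2 = v ^ 2) by (field; lra).
  destruct (Rle_lt_dec (Rabs (/ y * v)) 1) as [h|h].
  - assert (ha : Rabs (/ y * v) ^ 2 <= 1) by (generalize (Rabs_pos (/ y * v)); intros; nra).
    rewrite clamp_id by exact h; rewrite hv; apply Rmin_left.
    rewrite <- hv, <- (pow2_abs (/ y * v)); nra.
  - assert (ha : 1 <= Rabs (/ y * v) ^ 2) by nra.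
    rewrite clamp_sq_big by lra; rewrite Rmult_1_r; apply Rmin_right.
    rewrite <- hv, <- (pow2_abs (/ y * v)); nra.
Qed.

Lemma E_trunc y : 0 < y ->
  E (fun w => Rmin (X w ^ 2) (y ^ 2)) = Finite (y ^ 2 * pw lip_mean (/ y)).
Proof.
  intros Hy; replace (fun w => Rmin (X w ^ 2) (y ^ 2))
    with (fun w => y ^ 2 * clamp 1 (/ y * X w) ^ 2)
    by (apply functional_extensionality; intros; rewrite Rmin_sq; auto).
  assert (lc := proj1 (blip_clamp_sq (/ y))).
  apply E_scal_pos; [apply (H_lip _ _ lc HX)|apply (lip_mean_finite _ lc)|].
  apply pow2_ge_0.
Qed.

(** Any candidate xi for the capacity of |X| >= 1/b dominates f(X), so [lip_mean f] is below the
    infimum over xi. *)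
Lemma lip_mean_small_tail :
  (forall eps : R, 0 < eps -> exists M : R, forall y : R, M <= y ->
     Rbar_le (Vcap H E (fun w => y <= Rabs (X w)))
       (Rbar_mult (Finite (eps / y ^ 2)) (E (fun w => Rmin (X w ^ 2) (y ^ 2))))) ->
  small_tail lip_mean.
Proof.
  intros HI eps Heps; destruct (HI eps Heps) as [M HM].
  assert (m0 : 0 < Rmax M 1) by (generalize (Rmax_r M 1); lra).
  exists (/ Rmax M 1); split; [apply Rinv_0_lt_compat, m0|].
  intros b [Hb Hbm] f Hf h0 h1.
  assert (hy : 0 < / b) by apply Rinv_0_lt_compat, Hb.
  assert (My : M <= / b).
  { apply Rle_trans with (Rmax M 1); [apply Rmax_l|].
    rewrite <- (Rinv_inv (Rmax M 1)); apply Rinv_le_contravar; assumption. }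
  specialize (HM _ My); rewrite (E_trunc _ hy), Rinv_inv in HM.
  change (Rbar_le (Finite (lip_mean f)) (Finite (eps * pw lip_mean b))).
  eapply Rbar_le_trans; [|eapply Rbar_le_trans; [exact HM|]].
  - apply Vcap_ge; intros xi r Hxi k0 k1 kr.
    assert (hle : Rbar_le (E (fun w => f (X w))) (E xi)).
    { apply E_mono; [apply H_lip; assumption|exact Hxi|]; intros w.
      destruct (Rle_lt_dec (/ b) (Rabs (X w))) as [h|h].
      - apply Rle_trans with 1; auto.
      - apply Rle_trans with 0; [|apply k0]; apply h0.
        rewrite Rabs_mult, (Rabs_pos_eq b) by lra.
        apply Rmult_lt_compat_l with (r := b) in h; [|exact Hb].
        rewrite Rinv_r in h by lra; exact h. }
    rewrite lip_mean_finite, kr in hle by exact Hf; exact hle.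
  - simpl; right; field; lra.
Qed.

(** * Products of independent copies *)

Context (Xs : nat -> Omega -> R) (HXs : forall i, H (Xs i))
  (Hind : indep_seq H E Xs) (Hid : forall i, ident_distr E (Xs i) X).

(** Independence is applied to the product of n + 1 factors. Since g >= 0, the first n factors leave
    the inner expectation by positive homogeneity, so it is the shorter product times [lip_mean g],
    and induction applies. *)
Lemma E_pprod g n : blip g -> (forall u, 0 <= g u) ->
  H (fun w => pprod (fun i => g (Xs i w)) n) /\
  E (fun w => pprod (fun i => g (Xs i w)) n) = Finite (lip_mean g ^ n).
Proof.
  intros Hg g0.
  assert (HP : forall n, H (fun w => pprod (fun i => g (Xs i w)) n)).
  { intros k; apply (H_ClLip k Xs (fun v => pprod (fun i => g (v i)) k));
      auto using ClLip_pprod. }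
  split; [apply HP|].
  assert (m0 : 0 <= lip_mean g) 
    by (apply e_nonneg; [exact lip_mean_expectation|apply Hg|exact g0]).
  assert (hi : forall i, E (fun w => g (Xs i w)) = Finite (lip_mean g)).
  { intros i; rewrite <- lip_mean_finite by apply Hg.
    apply (Hid i (fun v => g (v 0%nat))); [apply ClLip_comp, Hg|].
    right; rewrite lip_mean_finite by apply Hg; reflexivity. }
  induction n as [|n IH]; [simpl; apply E_const|].
  assert (hcat : forall v y, pprod (fun i => g (vcat n v (fun _ : nat => y) i)) (S n)
                   = pprod (fun i => g (v i)) n * g y).
  { intros v y; simpl; unfold vcat at 2; rewrite Nat.ltb_irrefl; f_equal.
    apply pprod_ext; intros i hin; unfold vcat.
    apply Nat.ltb_lt in hin; rewrite hin; reflexivity. }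
  assert (hin : forall v, E (fun w => pprod (fun i => g (v i)) n * g (Xs n w))
                  = Finite (pprod (fun i => g (v i)) n * lip_mean g)).
  { intros v; apply E_scal_pos; [apply H_lip; [apply Hg|apply HXs]|apply hi|].
    apply pprod_nonneg; auto. }
  assert (hC : ClLip (n + 1) (fun v => pprod (fun i => g (v i)) (S n))).
  { rewrite Nat.add_1_r; apply ClLip_pprod, Hg. }
  assert (h := Hind n _ hC); cbv beta zeta in h.
  assert (e1 : forall v, (fun w => pprod (fun i => g (vcat n v (fun _ : nat => Xs n w) i)) (S n))
             = (fun w => pprod (fun i => g (v i)) n * g (Xs n w))).
  { intros v; apply functional_extensionality; intros w; apply hcat. }
  assert (e2 : forall v, (fun w => Rabs (pprod (fun i => g (vcat n v (fun _ : nat => Xs n w) i)) (S n)))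
             = (fun w => pprod (fun i => g (v i)) n * g (Xs n w))).
  { intros v; apply functional_extensionality; intros w; rewrite hcat.
    apply Rabs_pos_eq, Rmult_le_pos; auto using pprod_nonneg. }
  assert (e3 : (fun w => real (E (fun w' => pprod (fun i => g (vcat n
               (fun j => Xs j w) (fun _ : nat => Xs n w') i)) (S n))))
             = (fun w => lip_mean g * pprod (fun i => g (Xs i w)) n)).
  { apply functional_extensionality; intros w; rewrite e1, hin; simpl; ring. }
  assert (e4 : (fun w => Rabs (real (E (fun w' => Rabs (pprod (fun i => g (vcat n
               (fun j => Xs j w) (fun _ : nat => Xs n w') i)) (S n))))))
             = (fun w => lip_mean g * pprod (fun i => g (Xs i w)) n)).
  { apply functional_extensionality; intros w; rewrite e2, hin; simpl.
    rewrite Rabs_pos_eq; [ring|apply Rmult_le_pos; auto using pprod_nonneg]. }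
  assert (hs := E_scal_pos _ _ _ (HP n) IH m0).
  rewrite e3, e4, hs in h.
  rewrite <- (tech_pow_Rmult (lip_mean g) n), <- h.
  - f_equal; apply functional_extensionality; intros w; rewrite hcat; reflexivity.
  - intros v; rewrite e2, hin; exact I.
  - apply H_scal, HP.
  - apply H_scal, HP.
  - exact I.
Qed.

Lemma majorized_pprod c g n r : blip g -> (forall u, 0 <= g u) -> 0 <= c ->
  c * lip_mean g ^ n <= r ->
  majorized (fun w => c * pprod (fun i => g (Xs i w)) n) r.
Proof.
  intros Hg g0 c0 hr; destruct (E_pprod g n Hg g0) as [h1 h2].
  split; [apply H_scal, h1|split].
  - intros; apply Rmult_le_pos; auto using pprod_nonneg.
  - exists (c * lip_mean g ^ n); split; [apply E_scal_pos; assumption|exact hr].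
Qed.

Lemma majorized_le U r s : majorized U r -> r <= s -> majorized U s.
Proof.
  intros [h1 [h2 [a [h3 h4]]]] h; split; [exact h1|split; [exact h2|]].
  exists a; split; [exact h3|lra].
Qed.

Context (HI : small_tail lip_mean).

(** The expectation is at most (1 + (k + eps) p)^n <= exp((k + eps) n p), and n p = x^2. The
    coefficient k is separate from a^2/2 + d because for a negative coefficient it has to come from
    (II). *)
Lemma weight_majorized G a d k eps :
  expands G a d -> 0 <= a -> lip_mean (fun u => u) <= 0 -> 0 < eps ->
  (exists b1, 0 < b1 /\ forall b, 0 < b <= b1 ->
     lip_mean (fun u => (a ^ 2 / 2 + d) * clamp 1 (b * u) ^ 2) <= k * pw lip_mean b) ->
  exists b0, 0 < b0 /\ forall b, 0 < b <= b0 -> forall n x c,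
    INR n * pw lip_mean b = x ^ 2 ->
    majorized (fun w => exp (c * x ^ 2) * pprod (fun i => G (b * Xs i w)) n)
      (exp ((c + k + eps) * x ^ 2)).
Proof.
  intros HG Ha Hm Heps [b1 [Hb1 Hk]].
  destruct (expands_upper _ lip_mean_expectation HI lip_mean_ui G a d eps HG Ha Hm Heps)
    as [b2 [Hb2 HU]].
  exists (Rmin b1 b2); split; [apply Rmin_glb_lt; assumption|].
  intros b [Hb Hbm] n x c Hn.
  specialize (Hk b (conj Hb (Rle_trans _ _ _ Hbm (Rmin_l _ _)))).
  specialize (HU b (conj Hb (Rle_trans _ _ _ Hbm (Rmin_r _ _)))).
  destruct HG as [HG [HG0 _]].
  apply (majorized_pprod (exp (c * x ^ 2)) (fun u => G (b * u)) n).
  - apply blip_dil, HG.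
  - intros; apply HG0.
  - left; apply exp_pos.
  - rewrite Rplus_assoc, Rmult_plus_distr_r, exp_plus.
    apply Rmult_le_compat_l; [left; apply exp_pos|].
    apply pow_le_exp with (pw lip_mean b); [|exact Hn]; split; [|lra].
    apply e_nonneg; [exact lip_mean_expectation|apply lip_dil, HG|intros; apply HG0].
Qed.

Lemma weight_majorized_pos G a d k eps :
  expands G a d -> 0 <= a -> lip_mean (fun u => u) <= 0 -> 0 < eps ->
  a ^ 2 / 2 + d = k -> 0 <= k ->
  exists b0, 0 < b0 /\ forall b, 0 < b <= b0 -> forall n x c,
    INR n * pw lip_mean b = x ^ 2 ->
    majorized (fun w => exp (c * x ^ 2) * pprod (fun i => G (b * Xs i w)) n)
      (exp ((c + k + eps) * x ^ 2)).
Proof.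
  intros HG Ha Hm Heps Hk K0; apply weight_majorized with a d; auto.
  exists 1; split; [lra|]; intros b _; rewrite Hk.
  rewrite (e_scal _ lip_mean_expectation); [apply Rle_refl|apply blip_clamp_sq|exact K0].
Qed.

(** * The self-normalized event *)

Definition self_normalized_tail (n : nat) (x : R) : Omega -> Prop :=
  fun w => psum (fun i => Xs i w) n >= x * sqrt (psum (fun i => Xs i w ^ 2) n).

(** Both sides are homogeneous of degree one, so the scale b may be chosen freely. *)
Lemma self_normalized_tail_dil b n x w : 0 < b ->
  self_normalized_tail n x w <->
  x * sqrt (psum (fun i => (b * Xs i w) ^ 2) n) <= psum (fun i => b * Xs i w) n.
Proof.
  intros Hb; unfold self_normalized_tail; rewrite psum_scal.
  replace (psum (fun i => (b * Xs i w) ^ 2) n) with (b ^ 2 * psum (fun i => Xs i w ^ 2) n)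
    by (rewrite <- psum_scal; apply psum_ext; intros; ring).
  rewrite sqrt_mult_alt, sqrt_pow2 by (apply pow2_ge_0 || lra).
  rewrite <- Rmult_assoc, (Rmult_comm x b), Rmult_assoc.
  split; intros h; [apply Rmult_le_compat_l; lra|].
  apply Rle_ge, Rmult_le_reg_l with b; assumption.
Qed.

(* With p(b) = x^2/n the normalized quantity r = b V_n / x is split into r < r0,
   r >= 4 and a finite geometric grid of ratio 1 + eta in between. *)
Lemma Vcap_tail_upper K bK eps :
  0 < K -> 0 < bK ->
  (forall b, 0 < b <= bK ->
     pw lip_mean b <= K * - lip_mean (fun u => - clamp 1 (b * u) ^ 2)) ->
  lip_mean (fun u => u) <= 0 -> 0 < eps <= 1 / 2 ->
  exists J b0, 0 < b0 /\ forall b, 0 < b <= b0 -> forall n x, 0 < x ->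
    INR n * pw lip_mean b = x ^ 2 ->
    Rbar_le (Vcap H E (self_normalized_tail n x))
      (Finite (INR J * exp (- (1 / 2 - eps) * x ^ 2))).
Proof.
  intros HK HbK HII Hm Heps.
  (* With T = 4 K the constraint V_n small costs exp(T r0^2 x^2) = exp(2 x^2), while (II) makes the
     product of the weights at most exp((-4 + 1) x^2); the total exponent is -1. *)
  set (r0 := sqrt (/ (2 * K))).
  assert (Hd : 0 < / (2 * K)) by (apply Rinv_0_lt_compat; lra).
  assert (Hr0 : 0 < r0) by apply (sqrt_lt_R0 _ Hd).
  pose (eta := eps); assert (Heta : 0 < eta) by apply Heps.
  destruct (Pow_x_infinity (1 + eta) ltac:(rewrite Rabs_pos_eq; lra) (4 / r0)) as [J HJ].
  specialize (HJ J (Nat.le_refl J)).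
  rewrite Rabs_pos_eq in HJ by (apply pow_le; lra).
  assert (HJ' : 4 <= r0 * (1 + eta) ^ J).
  { replace 4 with (r0 * (4 / r0)) by (field; lra); apply Rmult_le_compat_l; lra. }
  set (rj := fun j => r0 * (1 + eta) ^ j).
  assert (Hrj : forall j, 0 < rj j) by (intros; apply Rmult_lt_0_compat; [|apply pow_lt]; lra).
  destruct (weight_majorized (quad_weight 0 (- (4 * K)) 1) 0 (- (4 * K)) (-4) 1)
    as [b1 [Hb1 M1]]; auto using quad_weight_expands; try lra.
  { apply quad_weight_expands; lra. }
  { exists bK; split; [exact HbK|]; intros b Hb; specialize (HII b Hb).
    replace (fun u => (0 ^ 2 / 2 + - (4 * K)) * clamp 1 (b * u) ^ 2)
      with (fun u => 4 * K * (- clamp 1 (b * u) ^ 2))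
      by (apply functional_extensionality; intros; field).
    rewrite (e_scal _ lip_mean_expectation (4 * K) (fun u => - clamp 1 (b * u) ^ 2));
      [lra|apply lip_opp, blip_clamp_sq|lra]. }
  (* For r >= 4 both weights also reach exponent -1: -8/4 + 0 + 1 for the tail weight with T = 8,
     and -4/2 + 1/2 + 1/2 for the clamped sum. *)
  destruct (weight_majorized_pos (tail_weight 8) 0 0 0 1) as [b2 [Hb2 M2]];
    auto using tail_weight_expands; try lra.
  destruct (weight_majorized_pos (quad_weight 1 0 1) 1 0 (1 / 2) (1 / 2)) as [b3 [Hb3 M3]];
    try lra.
  { apply quad_weight_expands; lra. }
  (* A common threshold for b exists because the grid is finite. With t = 1/rj, the level rj + 1
     satisfies both t M >= 1 and M >= 1/2. *)
  assert (Hgrid : forall k, exists b4, 0 < b4 /\ forall b, 0 < b <= b4 -> forall j, (j < k)%nat ->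
    forall n x c, INR n * pw lip_mean b = x ^ 2 ->
    majorized (fun w => exp (c * x ^ 2)
        * pprod (fun i => quad_weight (/ rj j) (- ((/ rj j) ^ 2 / 2)) (rj j + 1) (b * Xs i w)) n)
      (exp ((c + 0 + eps / 2) * x ^ 2))).
  { induction k as [|k [b4 [Hb4 IH]]].
    - exists 1; split; [lra|]; intros b _ j hj; lia.
    - specialize (Hrj k).
      destruct (weight_majorized_pos (quad_weight (/ rj k) (- ((/ rj k) ^ 2 / 2)) (rj k + 1))
        (/ rj k) (- ((/ rj k) ^ 2 / 2)) 0 (eps / 2)) as [b5 [Hb5 M5]]; try lra.
      { apply quad_weight_expands; lra. }
      { left; apply Rinv_0_lt_compat; lra. }
      exists (Rmin b4 b5); split; [apply Rmin_glb_lt; assumption|].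
      intros b [Hb Hbm] j hj.
      destruct (Nat.eq_dec j k) as [->|hne].
      + apply M5; split; [exact Hb|apply (Rle_trans _ _ _ Hbm), Rmin_r].
      + apply IH; [split; [exact Hb|apply (Rle_trans _ _ _ Hbm), Rmin_l]|lia]. }
  destruct (Hgrid J) as [b4 [Hb4 M4]]; clear Hgrid.
  exists (3 + J)%nat, (Rmin (Rmin b1 b2) (Rmin b3 b4)); split.
  { repeat apply Rmin_glb_lt; assumption. }
  intros b [Hb Hbm] n x Hx Hn.
  assert (q1 := Rle_trans _ _ _ Hbm (Rmin_l _ _)); assert (q2 := Rle_trans _ _ _ Hbm (Rmin_r _ _)).
  specialize (M1 b (conj Hb (Rle_trans _ _ _ q1 (Rmin_l _ _))) n x (4 * K * / (2 * K)) Hn).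
  specialize (M2 b (conj Hb (Rle_trans _ _ _ q1 (Rmin_r _ _))) n x (- (8 / 4)) Hn).
  specialize (M3 b (conj Hb (Rle_trans _ _ _ q2 (Rmin_l _ _))) n x (- (4 / 2)) Hn).
  assert (M4' := fun j hj => M4 b (conj Hb (Rle_trans _ _ _ q2 (Rmin_r _ _))) j hj n x
                    (- ((1 - eta ^ 2) / 2)) Hn).
  clear M4 Hbm q1 q2.
  set (r := exp (- (1 / 2 - eps) * x ^ 2)).
  assert (x2 : 0 < x ^ 2) by (apply pow_lt, Hx).
  assert (hexp : forall c, c <= - (1 / 2 - eps) -> exp (c * x ^ 2) <= r)
    by (intros; apply exp_le, Rmult_le_compat_r; lra).
  assert (hKK : 4 * K * / (2 * K) = 2) by (field; lra).
  apply (majorized_le _ _ r) in M1; [|apply hexp; rewrite hKK; lra].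
  apply (majorized_le _ _ r) in M2; [|apply hexp; lra].
  apply (majorized_le _ _ r) in M3; [|apply hexp; lra].
  assert (M4 : forall j, (j < J)%nat -> majorized (fun w => exp (- ((1 - eta ^ 2) / 2) * x ^ 2)
        * pprod (fun i => quad_weight (/ rj j) (- ((/ rj j) ^ 2 / 2)) (rj j + 1) (b * Xs i w)) n) r).
  { intros j hj; apply (majorized_le _ _ _ (M4' j hj)), hexp; unfold eta in *; nra. }
  assert (MJ := majorized_psum _ _ J X HX M4); cbv beta in MJ.
  assert (MU := majorized_plus _ _ _ _ M1 (majorized_plus _ _ _ _ M2
                  (majorized_plus _ _ _ _ M3 MJ))).
  replace (INR (3 + J) * r) with (r + (r + (r + INR J * r)))
    by (rewrite plus_INR; simpl; ring).
  apply (Vcap_upper _ _ _ MU); intros w hw.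
  apply (self_normalized_tail_dil b n x w Hb) in hw.
  set (u := fun i => b * Xs i w).
  change (fun i => b * Xs i w) with u in hw.
  change (fun i => (b * Xs i w) ^ 2) with (fun i => u i ^ 2) in hw.
  assert (P1 := proj1 (proj2 M1) w); assert (P2 := proj1 (proj2 M2) w).
  assert (P3 := proj1 (proj2 M3) w); assert (P4 := proj1 (proj2 MJ) w).
  cbv beta in P1, P2, P3, P4.
  set (v := sqrt (psum (fun i => u i ^ 2) n)).
  assert (q0 : 0 <= psum (fun i => u i ^ 2) n)
    by (apply psum_nonneg; intros; apply pow2_ge_0).
  destruct (Rle_lt_dec r0 (v / x)) as [h0|h0].
  - destruct (Rle_lt_dec 4 (v / x)) as [h4|h4].
    + assert (h := large_variance_weight u n x 8 4 Hx ltac:(lra) ltac:(lra)).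
      assert (hv : 4 * x <= v).
      { apply Rmult_le_compat_r with (r := x) in h4; [|lra].
        unfold Rdiv in h4; rewrite Rmult_assoc, Rinv_l in h4; lra. }
      specialize (h hv hw); unfold u in h; lra.
    + destruct (geometric_grid r0 eta (v / x) J Heta) as [j [hj hr]]; [lra|].
      change (r0 * (1 + eta) ^ j) with (rj j) in hr.
      replace (r0 * (1 + eta) ^ S j) with ((1 + eta) * rj j) in hr by (unfold rj; simpl; ring).
      assert (hrj := Hrj j).
      assert (hi : / rj j * rj j = 1) by (apply Rinv_l; lra).
      assert (hi0 : 0 < / rj j) by (apply Rinv_0_lt_compat; lra).
      assert (hv : v = v / x * x) by (field; lra).
      assert (h := mid_variance_weight u n x (/ rj j) eta (rj j + 1) Hx hi0).
      assert (hc : 1 <= / rj j * (rj j + 1)) by lra.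
      assert (hb : x <= / rj j * v <= (1 + eta) * x).
      { split.
        - apply Rle_trans with (/ rj j * (rj j * x)); [rewrite <- Rmult_assoc, hi; lra|].
          apply Rmult_le_compat_l; [lra|]; rewrite hv; apply Rmult_le_compat_r; lra.
        - apply Rle_trans with (/ rj j * ((1 + eta) * rj j * x)).
          + apply Rmult_le_compat_l; [lra|]; rewrite hv; apply Rmult_le_compat_r; lra.
          + right; field; lra. }
      specialize (h hc ltac:(lra) hb hw).
      (* The terms are set to 0 from J on, since [psum_ge_term] asks for nonnegativity at every
         index and [M4] supplies it only below J. *)
      assert (hle := psum_ge_term (fun j => if (j <? J)%nat then exp (- ((1 - eta ^ 2) / 2) * x ^ 2)
        * pprod (fun i => quad_weight (/ rj j) (- ((/ rj j) ^ 2 / 2)) (rj j + 1) (b * Xs i w)) n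
        else 0) J j).
      cbv beta in hle; rewrite (proj2 (Nat.ltb_lt j J) hj) in hle.
      rewrite (psum_ext _ (fun j => exp (- ((1 - eta ^ 2) / 2) * x ^ 2)
        * pprod (fun i => quad_weight (/ rj j) (- ((/ rj j) ^ 2 / 2)) (rj j + 1) (b * Xs i w)) n)) in hle
        by (intros i hij; rewrite (proj2 (Nat.ltb_lt i J) hij); reflexivity).
      assert (hle' := hle ltac:(intros i; destruct (i <? J)%nat eqn:hi';
        [apply (proj1 (proj2 (M4 i (proj1 (Nat.ltb_lt i J) hi'))) w)|lra]) hj).
      unfold u in h; lra.
  - assert (h := small_variance_weight u n x (4 * K) (/ (2 * K)) ltac:(lra)).
    assert (hq : psum (fun i => u i ^ 2) n <= / (2 * K) * x ^ 2).
    { assert (hv : v <= r0 * x).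
      { apply Rlt_le in h0; apply Rmult_le_compat_r with (r := x) in h0; [|lra].
        unfold Rdiv in h0; rewrite Rmult_assoc, Rinv_l in h0; lra. }
      assert (hv0 : 0 <= v) by apply sqrt_pos.
      rewrite <- (sqrt_sqrt _ q0), <- (sqrt_sqrt (/ (2 * K))) by lra.
      fold v r0; nra. }
    specialize (h hq); unfold u in h; lra.
Qed.

Lemma Vcap_tail_lower d :
  lip_mean (fun u => u) <= 0 -> lip_mean (fun u => - u) <= 0 -> 0 < d <= 1 ->
  exists b0 p0, 0 < b0 /\ 0 < p0 /\ forall b, 0 < b <= b0 -> pw lip_mean b <= p0 ->
    forall n x, 5 / d <= x -> INR n * pw lip_mean b = x ^ 2 ->
    Rbar_le (Finite (exp (- (1 / 2 + 8 * d) * x ^ 2)))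
      (Vcap H E (self_normalized_tail n x)).
Proof.
  intros Hm Hm' Hd.
  (* The main tilt has exponent lam^2/2 - k and each neighbour loses at least d^2/2 against it; with
     errors eps = d^2/8 on both sides a gap of d^2/4 remains. *)
  set (lam := 1 + 2 * d); set (k := lam * (lam + d)); set (eps := d ^ 2 / 8).
  assert (he : 0 < eps) by (unfold eps; nra).
  assert (he1 : eps <= 1 / 8) by (unfold eps; nra).
  assert (hlam : 1 <= lam) by (unfold lam; lra).
  destruct (expands_lower _ lip_mean_expectation HI lip_mean_ui (local_weight lam 0) lam 0
    (eps / 2)) as [b1 [Hb1 L1]]; auto using local_weight_expands; try lra; try nra.
  destruct (weight_majorized_pos (local_weight (lam + d) 0) (lam + d) 0
    ((lam + d) ^ 2 / 2 + 0) eps) as [b2 [Hb2 M2]]; auto using local_weight_expands; try lra; try nra.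
  destruct (weight_majorized_pos (local_weight lam d) lam d
    (lam ^ 2 / 2 + d) eps) as [b3 [Hb3 M3]]; auto using local_weight_expands; try lra; try nra.
  destruct (weight_majorized_pos (local_weight (lam - d) 0) (lam - d) 0
    ((lam - d) ^ 2 / 2 + 0) eps) as [b4 [Hb4 M4]];
    auto using local_weight_expands; try (unfold lam; lra); try nra.
  set (k1 := lam ^ 2 / 2 + 0 - eps / 2).
  (* The bound on p(b) keeps the quadratic loss k1^2 p(b) of [exp_le_pow] below eps/2; the added 1
     keeps the divisor positive. *)
  exists (Rmin (Rmin b1 b2) (Rmin b3 b4)), (eps / 2 / (k1 ^ 2 + 1)).
  assert (k1pos : 0 < k1 ^ 2 + 1) by (generalize (pow2_ge_0 k1); lra).
  split; [repeat apply Rmin_glb_lt; assumption|split; [apply Rdiv_lt_0_compat; lra|]].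
  intros b [Hb Hbm] Hp n x Hx Hn.
  assert (q1 := Rle_trans _ _ _ Hbm (Rmin_l _ _)); assert (q2 := Rle_trans _ _ _ Hbm (Rmin_r _ _)).
  specialize (L1 b (conj Hb (Rle_trans _ _ _ q1 (Rmin_l _ _)))).
  specialize (M2 b (conj Hb (Rle_trans _ _ _ q1 (Rmin_r _ _))) n x (- (k + d * (lam + d))) Hn).
  specialize (M3 b (conj Hb (Rle_trans _ _ _ q2 (Rmin_l _ _))) n x (- (k + d * (1 + d))) Hn).
  specialize (M4 b (conj Hb (Rle_trans _ _ _ q2 (Rmin_r _ _))) n x (- (k - d * (lam - d))) Hn).
  clear q1 q2 Hbm.
  assert (x0 : 0 < x) by (assert (0 < 5 / d) by (apply Rdiv_lt_0_compat; lra); lra).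
  assert (hdx : 25 <= d ^ 2 * x ^ 2).
  { assert (5 <= d * x).
    { apply Rmult_le_compat_l with (r := d) in Hx; [|lra].
      replace (d * (5 / d)) with 5 in Hx by (field; lra); exact Hx. }
    nra. }
  set (z := x ^ 2) in *.
  assert (z0 : 0 < z) by (apply pow_lt, x0).
  set (g := fun u => local_weight lam 0 (b * u)).
  assert (Hg := local_weight_expands lam 0).
  destruct (E_pprod g n (blip_dil b _ (proj1 Hg)) (fun u => proj1 (proj2 Hg) (b * u)))
    as [HU EU].
  assert (EU' := E_scal_pos (exp (- k * z)) _ _ HU EU ltac:(left; apply exp_pos)).
  assert (p0 := pw_nonneg _ lip_mean_expectation b).
  assert (hs : exp ((k1 - eps / 2) * z) <= lip_mean g ^ n).
  { apply exp_le_pow with (pw lip_mean b); auto.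
    - unfold k1; nra.
    - apply Rle_trans with ((k1 ^ 2 + 1) * (eps / 2 / (k1 ^ 2 + 1))).
      + apply Rmult_le_compat; try lra; apply pow2_ge_0.
      + right; field; lra. }
  set (r := exp ((lam ^ 2 / 2 - k - d ^ 2 / 2 + eps) * z)).
  assert (hr : forall c, c <= lam ^ 2 / 2 - k - d ^ 2 / 2 + eps -> exp (c * z) <= r)
    by (intros; apply exp_le, Rmult_le_compat_r; lra).
  apply (majorized_le _ _ r) in M2; [|apply hr; nra].
  apply (majorized_le _ _ r) in M3; [|apply hr; nra].
  apply (majorized_le _ _ r) in M4; [|apply hr; nra].
  assert (MW := majorized_plus _ _ _ _ M2 (majorized_plus _ _ _ _ M3 M4)).
  eapply Rbar_le_trans; [|eapply (Vcap_lower _ _ _ _ _ (H_scal (exp (- k * z)) _ HU) EU' MW)].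
  - set (s := exp ((lam ^ 2 / 2 - k - eps) * z)).
    assert (hS : s <= exp (- k * z) * lip_mean g ^ n).
    { apply Rle_trans with (exp (- k * z) * exp ((k1 - eps / 2) * z)).
      - rewrite <- exp_plus; right; unfold s, k1; f_equal; field.
      - apply Rmult_le_compat_l; [left; apply exp_pos|exact hs]. }
    assert (hexp : forall y, 0 <= y -> exp (- y) <= / (1 + y)).
    { intros y hy; rewrite exp_Ropp; apply Rinv_le_contravar; [lra|apply exp_ineq1_le]. }
    assert (s0 : 0 < s) by apply exp_pos.
    (* Since d^2 z >= 25, the gap factor exp(-d^2 z / 4) is below 1/6: the three neighbours together
       take at most half of the main term. *)
    assert (hrs : r <= s * / 6).
    { replace r with (s * exp (- (d ^ 2 * z / 4)))
        by (unfold r, s; rewrite <- exp_plus; f_equal; unfold eps; field).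
      apply Rmult_le_compat_l; [lra|]; eapply Rle_trans; [apply hexp; lra|].
      apply Rinv_le_contravar; lra. }
    assert (hfin : exp (- (1 / 2 + 8 * d) * z) <= s * / 2).
    { apply Rle_trans with (s * exp (- (eps * z))).
      - unfold s; rewrite <- exp_plus; apply exp_le.
        replace ((lam ^ 2 / 2 - k - eps) * z + - (eps * z))
          with ((lam ^ 2 / 2 - k - 2 * eps) * z) by ring.
        apply Rmult_le_compat_r; [lra|]; unfold k, lam, eps; nra.
      - assert (1 <= eps * z) by (unfold eps; lra).
        apply Rmult_le_compat_l; [lra|]; eapply Rle_trans; [apply hexp; lra|].
        apply Rinv_le_contravar; lra. }
    simpl; lra.
  - intros w _.
    exact (proj1 (lower_weight (fun i => b * Xs i w) n x d x0 (proj1 Hd))).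
  - intros w hw.
    apply (proj2 (lower_weight (fun i => b * Xs i w) n x d x0 (proj1 Hd))).
    apply Rnot_le_lt; intros hc; apply hw, (self_normalized_tail_dil b n x w Hb), hc.
Qed.

(** Condition (II) at y = 1/b. Its strict positivity also gives p(b) > 0, which makes n p(b) = x_n^2
    solvable at small scales. *)
Lemma variance_ratio :
  (exists K M : R, forall y : R, M <= y ->
     Rbar_lt (Finite 0) (calE E (fun w => Rmin (X w ^ 2) (y ^ 2))) /\
     Rbar_le (E (fun w => Rmin (X w ^ 2) (y ^ 2)))
             (Rbar_mult (Finite K) (calE E (fun w => Rmin (X w ^ 2) (y ^ 2))))) ->
  exists K bK, 0 < K /\ 0 < bK /\ forall b, 0 < b <= bK ->
    0 < pw lip_mean b /\
    pw lip_mean b <= K * - lip_mean (fun u => - clamp 1 (b * u) ^ 2).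
Proof.
  intros [K [M HK]].
  assert (m0 : 0 < Rmax M 1) by (generalize (Rmax_r M 1); lra).
  assert (K0 : 0 < Rmax K 1) by (generalize (Rmax_r K 1); lra).
  exists (Rmax K 1), (/ Rmax M 1).
  split; [exact K0|split; [apply Rinv_0_lt_compat, m0|]].
  intros b [Hb Hbm].
  assert (hy : 0 < / b) by apply Rinv_0_lt_compat, Hb.
  assert (hy2 : 0 < (/ b) ^ 2) by apply pow_lt, hy.
  assert (My : M <= / b).
  { apply Rle_trans with (Rmax M 1); [apply Rmax_l|].
    rewrite <- (Rinv_inv (Rmax M 1)); apply Rinv_le_contravar; assumption. }
  specialize (HK _ My); rewrite (E_trunc _ hy), Rinv_inv in HK.
  assert (lc := lip_opp _ (proj1 (blip_clamp_sq b))).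
  set (m := lip_mean (fun u => - clamp 1 (b * u) ^ 2)).
  assert (hc : calE E (fun w => Rmin (X w ^ 2) ((/ b) ^ 2)) = Finite (- ((/ b) ^ 2 * m))).
  { unfold calE; replace (fun w => - Rmin (X w ^ 2) ((/ b) ^ 2))
      with (fun w => (/ b) ^ 2 * - clamp 1 (b * X w) ^ 2).
    - rewrite (E_scal_pos _ _ m (H_lip _ _ lc HX) (lip_mean_finite _ lc)); [reflexivity|lra].
    - apply functional_extensionality; intros w.
      rewrite Rmin_sq, Rinv_inv by exact hy; ring. }
  rewrite hc in HK; destruct HK as [h1 h2]; simpl Rbar_lt in h1; simpl Rbar_le in h2.
  assert (hm : 0 < - m).
  { apply Rmult_lt_reg_l with ((/ b) ^ 2); [exact hy2|lra]. }
  assert (hp : pw lip_mean b <= Rmax K 1 * - m).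
  { apply Rle_trans with (K * - m).
    - apply Rmult_le_reg_l with ((/ b) ^ 2); [exact hy2|lra].
    - apply Rmult_le_compat_r; [lra|apply Rmax_l]. }
  split; [|exact hp].
  apply Rlt_le_trans with (- m); [exact hm|].
  (* The lower second moment is at most the upper one, by 0 = e(f - f) <= e(f) + e(-f). *)
  assert (h0 := e_plus _ lip_mean_expectation _ _ (proj1 (blip_clamp_sq b)) lc); cbv beta in h0.
  replace (fun u => clamp 1 (b * u) ^ 2 + - clamp 1 (b * u) ^ 2) with (fun _ : R => 0) in h0
    by (apply functional_extensionality; intros; ring).
  rewrite (e_const _ lip_mean_expectation) in h0.
  unfold pw, m; lra.
Qed.

(** * Choice of the scale and the asymptotic bounds *)

Context (HII : exists K M : R, forall y : R, M <= y ->
     Rbar_lt (Finite 0) (calE E (fun w => Rmin (X w ^ 2) (y ^ 2))) /\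
     Rbar_le (E (fun w => Rmin (X w ^ 2) (y ^ 2)))
             (Rbar_mult (Finite K) (calE E (fun w => Rmin (X w ^ 2) (y ^ 2))))).
Context (x : nat -> R) (Hx1 : is_lim_seq x p_infty)
  (Hx2 : is_lim_seq (fun n => x n / sqrt (INR n)) 0).

(** By (IV), x_n^2 / n tends to 0, so it eventually falls into the range of p on (0, b1] and below
    p0. *)
Lemma eventual_scale b1 p0 L : 0 < b1 -> 0 < p0 ->
  exists N : nat, forall n : nat, (N <= n)%nat -> L < x n /\ 0 < x n /\
    exists b, 0 < b <= b1 /\ pw lip_mean b <= p0 /\ INR n * pw lip_mean b = x n ^ 2.
Proof.
  intros Hb1 Hp0; destruct (variance_ratio HII) as [K [bK [K0 [HbK HK]]]].
  set (b2 := Rmin b1 bK).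
  assert (Hb2 : 0 < b2) by (apply Rmin_glb_lt; assumption).
  destruct (HK b2 (conj Hb2 (Rmin_r _ _))) as [hp _].
  set (y0 := Rmin p0 (pw lip_mean b2)).
  assert (Hy0 : 0 < y0) by (apply Rmin_glb_lt; assumption).
  assert (Hsq := is_lim_seq_mult' _ _ _ _ Hx2 Hx2); rewrite Rmult_0_l in Hsq.
  apply is_lim_seq_spec in Hsq; apply is_lim_seq_spec in Hx1.
  destruct (Hsq (mkposreal y0 Hy0)) as [N1 HN1], (Hx1 (Rmax L 0)) as [N2 HN2].
  simpl in HN1; exists (Nat.max 1 (Nat.max N1 N2)); intros n hn.
  specialize (HN1 n ltac:(lia)); specialize (HN2 n ltac:(lia)).
  assert (n0 : 0 < INR n) by (apply lt_0_INR; lia).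
  assert (hs := sqrt_sqrt (INR n) ltac:(lra)).
  assert (hs0 : 0 < sqrt (INR n)) by (apply sqrt_lt_R0, n0).
  assert (hx0 : 0 < x n) by (generalize (Rmax_r L 0); lra).
  split; [generalize (Rmax_l L 0); lra|split; [exact hx0|]].
  assert (hz : x n / sqrt (INR n) * (x n / sqrt (INR n)) = x n ^ 2 / INR n)
    by (rewrite <- hs at 3; field; lra).
  assert (hz0 : 0 < x n ^ 2 / INR n) by (apply Rdiv_lt_0_compat; [apply pow_lt|]; lra).
  rewrite hz, Rminus_0_r, Rabs_pos_eq in HN1 by lra.
  assert (hy1 : y0 <= p0) by apply Rmin_l.
  assert (hy2 : y0 <= pw lip_mean b2) by apply Rmin_r.
  destruct (pw_reaches _ lip_mean_expectation b2 (x n ^ 2 / INR n) Hb2) as [b [hb hpb]]; [lra|].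
  exists b; split; [|split].
  - split; [apply hb|]; apply Rle_trans with b2; [apply hb|apply Rmin_l].
  - lra.
  - rewrite hpb; field; lra.
Qed.

Lemma eventual_upper eps : lip_mean (fun u => u) <= 0 -> 0 < eps ->
  exists N : nat, forall n : nat, (N <= n)%nat -> 0 < x n /\
    real (Vcap H E (self_normalized_tail n (x n))) <= exp ((-1 / 2 + eps) * x n ^ 2).
Proof.
  intros Hm Heps; destruct (variance_ratio HII) as [K [bK [K0 [HbK HK]]]].
  set (e' := Rmin (eps / 2) (1 / 2)).
  assert (he : 0 < e' <= 1 / 2) by (split; [apply Rmin_glb_lt; lra|apply Rmin_r]).
  assert (he2 : e' <= eps / 2) by apply Rmin_l.
  destruct (Vcap_tail_upper K bK e' K0 HbK (fun b hb => proj2 (HK b hb)) Hm he)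
    as [J [b0 [Hb0 HV]]].
  (* This lower bound on x_n gives INR J <= eps/2 x_n^2 <= exp(eps/2 x_n^2), which absorbs the
     number of terms in the majorant. *)
  destruct (eventual_scale b0 1 (1 + 2 * INR J / eps) Hb0 ltac:(lra)) as [N HN].
  exists N; intros n hn; destruct (HN n hn) as [hL [hx [b [hb [_ hnp]]]]].
  split; [exact hx|].
  specialize (HV b hb n (x n) hx hnp).
  destruct (Vcap_finite (self_normalized_tail n (x n))) as [_ hf].
  rewrite <- hf in HV; simpl in HV; eapply Rle_trans; [exact HV|].
  set (z := x n ^ 2).
  assert (hJ0 : 0 <= 2 * INR J / eps).
  { apply Rmult_le_pos; [generalize (pos_INR J); lra|left; apply Rinv_0_lt_compat, Heps]. }
  assert (hz : 2 * INR J / eps <= z) by (unfold z; nra).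
  assert (hz0 : 0 <= z) by apply pow2_ge_0.
  assert (hJ : INR J <= exp (eps / 2 * z)).
  { apply Rle_trans with (eps / 2 * z); [|generalize (exp_ineq1_le (eps / 2 * z)); lra].
    replace (INR J) with (eps / 2 * (2 * INR J / eps)) by (field; lra).
    apply Rmult_le_compat_l; lra. }
  apply Rle_trans with (exp (eps / 2 * z) * exp (- (1 / 2 - e') * z)).
  - apply Rmult_le_compat_r; [left; apply exp_pos|exact hJ].
  - rewrite <- exp_plus, <- Rmult_plus_distr_r; apply exp_le, Rmult_le_compat_r; lra.
Qed.

Lemma eventual_lower eps :
  lip_mean (fun u => u) <= 0 -> lip_mean (fun u => - u) <= 0 -> 0 < eps ->
  exists N : nat, forall n : nat, (N <= n)%nat -> 0 < x n /\
    exp ((-1 / 2 - eps) * x n ^ 2) <= real (Vcap H E (self_normalized_tail n (x n))).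
Proof.
  intros Hm Hm' Heps; set (d := Rmin (eps / 8) 1).
  assert (hd : 0 < d <= 1) by (split; [apply Rmin_glb_lt; lra|apply Rmin_r]).
  assert (hd2 : d <= eps / 8) by apply Rmin_l.
  destruct (Vcap_tail_lower d Hm Hm' hd) as [b0 [p0 [Hb0 [Hp0 HV]]]].
  destruct (eventual_scale b0 p0 (5 / d) Hb0 Hp0) as [N HN].
  exists N; intros n hn; destruct (HN n hn) as [hL [hx [b [hb [hp hnp]]]]].
  split; [exact hx|].
  specialize (HV b hb hp n (x n) ltac:(lra) hnp).
  destruct (Vcap_finite (self_normalized_tail n (x n))) as [_ hf].
  rewrite <- hf in HV; simpl in HV; eapply Rle_trans; [|exact HV].
  apply exp_le, Rmult_le_compat_r; [apply pow2_ge_0|lra].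
Qed.

End Space.

(** [ln] is total with a default value at 0. Hence the limit is accompanied by eventual positivity
    of the capacity, and in the one-sided bound a vanishing capacity is a separate alternative
    standing for the logarithm minus infinity. *)
Theorem theorem3p2 (Omega : Type) (H : (Omega -> R) -> Prop)
  (E : (Omega -> R) -> Rbar) (X : Omega -> R) (Xs : nat -> Omega -> R)
  (x : nat -> R) :
  sublinear_space H E ->
  H X -> (forall i, H (Xs i)) ->
  indep_seq H E Xs ->
  (forall i, ident_distr E (Xs i) X) ->
  (* (I)  V(|X| >= y) = o(y^-2 l(y)), l(y) = E[X^2 /\ y^2] *)
  (forall eps : R, 0 < eps -> exists M : R, forall y : R, M <= y ->
     Rbar_le (Vcap H E (fun w => y <= Rabs (X w)))
       (Rbar_mult (Finite (eps / y ^ 2)) (E (fun w => Rmin (X w ^ 2) (y ^ 2))))) ->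
  (* (II) limsup E[X^2 /\ y^2] / calE[X^2 /\ y^2] < oo *)
  (exists K M : R, forall y : R, M <= y ->
     Rbar_lt (Finite 0) (calE E (fun w => Rmin (X w ^ 2) (y ^ 2))) /\
     Rbar_le (E (fun w => Rmin (X w ^ 2) (y ^ 2)))
             (Rbar_mult (Finite K) (calE E (fun w => Rmin (X w ^ 2) (y ^ 2))))) ->
  (* (III) E[(|X| - c)^+] -> 0 *)
  (forall eps : R, 0 < eps -> exists M : R, forall c : R, M <= c ->
     Rbar_le (E (fun w => Rmax (Rabs (X w) - c) 0)) (Finite eps)) ->
  (* (IV) x_n -> oo, x_n = o(sqrt n) *)
  is_lim_seq x p_infty ->
  is_lim_seq (fun n => x n / sqrt (INR n)) 0 ->
  (E X = Finite 0 -> calE E X = Finite 0 ->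
     (exists N : nat, forall n : nat, (N <= n)%nat ->
        Rbar_lt (Finite 0) (Vcap H E (fun w => psum (fun i => Xs i w) n
                               >= x n * sqrt (psum (fun i => Xs i w ^ 2) n)))) /\
     is_lim_seq (fun n => ln (real (Vcap H E (fun w => psum (fun i => Xs i w) n
                               >= x n * sqrt (psum (fun i => Xs i w ^ 2) n))))
                          / x n ^ 2) (-1/2))
  /\
  (Rbar_le (E X) (Finite 0) ->
     forall eps : R, 0 < eps -> exists N : nat, forall n : nat, (N <= n)%nat ->
       Rbar_le (Vcap H E (fun w => psum (fun i => Xs i w) n
                               >= x n * sqrt (psum (fun i => Xs i w ^ 2) n))) (Finite 0)
       \/
       ln (real (Vcap H E (fun w => psum (fun i => Xs i w) n
                               >= x n * sqrt (psum (fun i => Xs i w ^ 2) n))))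
         / x n ^ 2 <= -1/2 + eps).
Proof.
  intros HE HX HXs Hind Hid HI HII HIII Hx1 Hx2.
  assert (HT := lip_mean_small_tail _ _ _ HE X HX HIII HI).
  assert (Hm : E X = Finite (lip_mean Omega E X (fun u => u)))
    by exact (lip_mean_finite _ _ _ HE X HX HIII _ lip_id).
  assert (Hm' : E (fun w => - X w) = Finite (lip_mean Omega E X (fun u => - u)))
    by exact (lip_mean_finite _ _ _ HE X HX HIII _ (lip_opp _ lip_id)).
  assert (HU := fun eps => eventual_upper _ _ _ HE X HX HIII Xs HXs Hind Hid HT HII x Hx1 Hx2 eps).
  assert (HL := fun eps => eventual_lower _ _ _ HE X HX HIII Xs HXs Hind Hid HT HII x Hx1 Hx2 eps).
  change (fun n => ln (real (Vcap H E (fun w => psum (fun i => Xs i w) n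
            >= x n * sqrt (psum (fun i => Xs i w ^ 2) n)))) / x n ^ 2)
    with (fun n => ln (real (Vcap H E (self_normalized_tail Omega Xs n (x n)))) / x n ^ 2).
  assert (Hln : forall n c, 0 < x n ->
    0 < real (Vcap H E (self_normalized_tail Omega Xs n (x n))) ->
    real (Vcap H E (self_normalized_tail Omega Xs n (x n))) <= exp (c * x n ^ 2) ->
    ln (real (Vcap H E (self_normalized_tail Omega Xs n (x n)))) / x n ^ 2 <= c).
  { intros n c hx h0 h1; assert (x2 : 0 < x n ^ 2) by (apply pow_lt, hx).
    apply ln_le in h1; [|exact h0]; rewrite ln_exp in h1.
    apply Rmult_le_reg_r with (x n ^ 2); [exact x2|].
    unfold Rdiv; rewrite Rmult_assoc, Rinv_l by lra; lra. }
  assert (Hln' : forall n c, 0 < x n ->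
    exp (c * x n ^ 2) <= real (Vcap H E (self_normalized_tail Omega Xs n (x n))) ->
    c <= ln (real (Vcap H E (self_normalized_tail Omega Xs n (x n)))) / x n ^ 2).
  { intros n c hx h1; assert (x2 : 0 < x n ^ 2) by (apply pow_lt, hx).
    apply ln_le in h1; [|apply exp_pos]; rewrite ln_exp in h1.
    apply Rmult_le_reg_r with (x n ^ 2); [exact x2|].
    unfold Rdiv; rewrite Rmult_assoc, Rinv_l by lra; lra. }
  split.
  - intros E0 E0'; rewrite Hm in E0; injection E0 as E0.
    unfold calE in E0'; rewrite Hm' in E0'; injection E0' as E0'.
    split.
    + destruct (HL 1 ltac:(lra) ltac:(lra) ltac:(lra)) as [N HN]; exists N; intros n hn.
      destruct (HN n hn) as [_ h].
      change (Rbar_lt (Finite 0) (Vcap H E (self_normalized_tail Omega Xs n (x n)))).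
      rewrite <- (proj2 (Vcap_finite _ _ _ HE X HX _)); simpl.
      eapply Rlt_le_trans; [apply exp_pos|exact h].
    + apply is_lim_seq_spec; intros eps.
      assert (he := cond_pos eps).
      destruct (HU (eps / 2) ltac:(lra) ltac:(lra)) as [N1 HN1].
      destruct (HL (eps / 2) ltac:(lra) ltac:(lra) ltac:(lra)) as [N2 HN2].
      exists (Nat.max N1 N2); intros n hn.
      destruct (HN1 n ltac:(lia)) as [hx h1], (HN2 n ltac:(lia)) as [_ h2].
      assert (h0 := Rlt_le_trans _ _ _ (exp_pos _) h2).
      assert (h3 := Hln _ _ hx h0 h1); assert (h4 := Hln' _ _ hx h2).
      apply Rabs_lt_between; lra.
  - intros E0 eps Heps; rewrite Hm in E0; simpl in E0.
    destruct (HU eps E0 Heps) as [N HN]; exists N; intros n hn.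
    destruct (HN n hn) as [hx h1].
    change (fun w => psum (fun i => Xs i w) n >= x n * sqrt (psum (fun i => Xs i w ^ 2) n))
      with (self_normalized_tail Omega Xs n (x n)).
    destruct (Rle_lt_dec (real (Vcap H E (self_normalized_tail Omega Xs n (x n)))) 0) as [h|h].
    + left; rewrite <- (proj2 (Vcap_finite _ _ _ HE X HX _)); exact h.
    + right; apply (Hln _ _ hx h h1).
Qed.
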